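(* Let $M$ be a smooth finite-dimensional manifold, let $\pi$ be a smooth Poisson structure on $M$, let $k\ge 1$ be an integer, and let $m\in M$ be a singularity of order $k$ of $\pi$, with $k$-homogeneous part $\pi^{(k)}$ at $m$ (a $k$-homogeneous Poisson structure on the vector space $T_mM$). Equip the space $\mathcal{V}_2(M)$ of smooth bivector fields on $M$ with the $\mathcal{C}^{2k}$-topology. If $H^{2,s}_{\rm LP}(\pi^{(k)})=\{0\}$ for every $s=0,\dots,k-1$, then $m$ is a $k$-stable singularity of $\pi$; that is, for every neighborhood $\Omega$ of $m$ in $M$ there is a neighborhood $\mathcal{W}$ of $\pi$ in $\mathcal{V}_2(M)$ such that every Poisson structure belonging to $\mathcal{W}$ has a singularity of order $k$ in $\Omega$.
   Context: A smooth Poisson structure on $M$ is a smooth bivector field $\pi$ with $[\pi,\pi]=0$, where $[\ ,\ ]$ is the Schouten–Nijenhuis bracket on multivector fields. $\mathcal{V}_2(M)$ is the set of all smooth bivector fields on $M$, regarded as maps $M\to\bigwedge^2TM$; its $\mathcal{C}^{s}$-topology is the topology of uniform convergence on compact sets of the maps and their derivatives up to order $s$. A singularity of order $k$ ($k>0$) of a Poisson structure $\pi$ is a point $m\in M$ at which the $(k-1)$-jet of $\pi$ vanishes but the $k$-jet of $\pi$ does not. The $k$-th order terms of the Taylor expansion of $\pi$ at such a point $m$ determine (up to isomorphism) a Poisson structure $\pi^{(k)}$ on the vector space $T_mM$ whose coefficients in linear coordinates are homogeneous polynomials of degree $k$; it is called the $k$-homogeneous part of $\pi$ at $m$. $\mathcal{V}_r^{(s)}(T_mM)$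 denotes the space of $s$-homogeneous $r$-vector fields on $T_mM$, i.e. $r$-vector fields whose coefficients in linear coordinates are homogeneous polynomials of degree $s$; $\mathcal{V}_r^{(s)}(T_mM)=\{0\}$ for $s<0$. For each $r,\ell$ define $\partial_r^{\ell}:\mathcal{V}_r^{(\ell)}(T_mM)\to\mathcal{V}_{r+1}^{(\ell+k-1)}(T_mM)$ by $\partial_r^{\ell}(A)=[\pi^{(k)},A]$. Then $$H^{2,s}_{\rm LP}(\pi^{(k)})=\frac{\ker\big(\partial_2^{s}:\mathcal{V}_2^{(s)}(T_mM)\to\mathcal{V}_3^{(s+k-1)}(T_mM)\big)}{\operatorname{Im}\big(\partial_1^{s-k+1}:\mathcal{V}_1^{(s-k+1)}(T_mM)\to\mathcal{V}_2^{(s)}(T_mM)\big)}.$$ *)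

(* Defs.v *)
From HB Require Import structures.
From mathcomp Require Import all_boot all_order all_algebra.
From mathcomp Require Import all_classical all_reals all_analysis.
Set Implicit Arguments.
Unset Strict Implicit.
Unset Printing Implicit Defensive.
Import Order.TTheory GRing.Theory Num.Theory.
Import numFieldNormedType.Exports.
Local Open Scope classical_set_scope.
Local Open Scope ring_scope.

Definition partial (R : realType) (n : nat) (i : 'I_n) (f : 'rV[R]_n -> R) :
    'rV[R]_n -> R :=
  fun x => 'D_(delta_mx 0 i) f x.

Definition iter_partial (R : realType) (n : nat) (s : seq 'I_n)
    (f : 'rV[R]_n -> R) : 'rV[R]_n -> R :=
  foldr (@partial R n) f s.

(* C^oo on the open set U: the partial derivatives of all orders exist and are
   differentiable (hence continuous) on U. *)
Definition smooth_on (R : realType) (n : nat) (U : set 'rV[R]_n)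
    (f : 'rV[R]_n -> R) : Prop :=
  forall (s : seq 'I_n) (x : 'rV[R]_n), U x -> differentiable (iter_partial s f) x.

(* A chart is a homeomorphism from an open subset of M onto an open subset of
   R^n; the two underlying maps are total, with irrelevant values outside
   chart_dom and chart_img. *)
Record chart (R : realType) (n : nat) (M : topologicalType) := Chart {
  chart_dom : set M;
  chart_img : set 'rV[R]_n;
  chart_map : M -> 'rV[R]_n;
  chart_inv : 'rV[R]_n -> M;
  chart_dom_open : open chart_dom;
  chart_img_open : open chart_img;
  chart_map_in : forall p, chart_dom p -> chart_img (chart_map p);
  chart_inv_in : forall x, chart_img x -> chart_dom (chart_inv x);
  chart_mapK : forall p, chart_dom p -> chart_inv (chart_map p) = p;
  chart_invK : forall x, chart_img x -> chart_map (chart_inv x) = x;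
  chart_map_cont : {within chart_dom, continuous chart_map};
  chart_inv_cont : {within chart_img, continuous chart_inv} }.

Definition transition (R : realType) (n : nat) (M : topologicalType)
    (c d : chart R n M) : 'rV[R]_n -> 'rV[R]_n :=
  fun x => chart_map d (chart_inv c x).

(* The atlas need not be maximal. *)
Record smooth_manifold (R : realType) (n : nat) := SmoothManifold {
  mpoint :> topologicalType;
  mf_hausdorff : hausdorff_space mpoint;
  mf_second_countable : @second_countable mpoint;
  chart_idx : Type;
  chart_at : chart_idx -> chart R n mpoint;
  mf_cover : forall p : mpoint, exists c, chart_dom (chart_at c) p;
  mf_smooth : forall (c d : chart_idx) (j : 'I_n),
    smooth_on
      [set x | chart_img (chart_at c) x /\
               chart_dom (chart_at d) (chart_inv (chart_at c) x)]
      (fun x => transition (chart_at c) (chart_at d) x 0 j) }.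

(* A smooth bivector field, i.e. a smooth section of the second exterior power
   of the tangent bundle, given by its components in the charts:
   the skew matrix bv_loc c x is (pi^{ij}(x))_{i,j}, where
   pi = 1/2 sum_{i,j} pi^{ij} d/dx_i /\ d/dx_j in the coordinates of c.
   The library's jacobian acts on row vectors, ('J f x) i j = d f_j / d x_i,
   so bv_change reads
   pi'^{jl} = sum_{i,k} (dy_j/dx_i) (dy_l/dx_k) pi^{ik}.
   bv_out only fixes the irrelevant values. *)
Record bivector_field (R : realType) (n : nat) (M : smooth_manifold R n) :=
  BivectorField {
  bv_loc :> chart_idx M -> 'rV[R]_n -> 'M[R]_n;
  bv_skew : forall c x, (bv_loc c x)^T = - bv_loc c x;
  bv_smooth : forall c i j,
    smooth_on (chart_img (chart_at c)) (fun x => bv_loc c x i j);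
  bv_change : forall c d (p : M),
    chart_dom (chart_at c) p -> chart_dom (chart_at d) p ->
    let x := chart_map (chart_at c) p in
    let J := jacobian (transition (chart_at c) (chart_at d)) x in
    bv_loc d (chart_map (chart_at d) p) = J^T *m bv_loc c x *m J;
  bv_out : forall c x, ~ chart_img (chart_at c) x -> bv_loc c x = 0 }.

(* Schouten-Nijenhuis bracket of two bivector fields on R^n, as the array of
   coefficients of the resulting trivector field.  This is the case a = b = 2
   of the formula
     [A,B] = sum_h dA/dz_h dB/dx_h - (-1)^((a-1)(b-1)) dB/dz_h dA/dx_h
   (z_h = d/dx_h odd variables, d/dz_h acting from the right). *)
Definition schouten22 (R : realType) (n : nat) (A B : 'rV[R]_n -> 'M[R]_n)
    (i j l : 'I_n) : 'rV[R]_n -> R :=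
  let term (C D : 'rV[R]_n -> 'M[R]_n) (i j l : 'I_n) (x : 'rV[R]_n) : R :=
    \sum_(h < n) C x i h * partial h (fun y => D y j l) x in
  fun x => (term A B i j l x + term A B j l i x + term A B l i j x)
         + (term B A i j l x + term B A j l i x + term B A l i j x).

(* The case a = 2, b = 1 of the same formula; it equals minus the Lie
   derivative of A along X. *)
Definition schouten21 (R : realType) (n : nat) (A : 'rV[R]_n -> 'M[R]_n)
    (X : 'rV[R]_n -> 'rV[R]_n) : 'rV[R]_n -> 'M[R]_n :=
  fun x => \matrix_(i, j)
    \sum_(h < n) (A x i h * partial h (fun y => X y 0 j) x
                + A x h j * partial h (fun y => X y 0 i) x
                - X x 0 h * partial h (fun y => A y i j) x).

Definition poisson (R : realType) (n : nat) (M : smooth_manifold R n)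
    (pi : bivector_field M) : Prop :=
  forall (c : chart_idx M) (x : 'rV[R]_n), chart_img (chart_at c) x ->
    forall i j l : 'I_n, schouten22 (pi c) (pi c) i j l x = 0.

(* Neighborhoods of pi for the topology of uniform convergence on compact sets
   of the components and their derivatives up to order s: the basic ones are
   given by finitely many compact sets, each inside a chart domain. *)
Definition Cs_nbhs (R : realType) (n : nat) (M : smooth_manifold R n) (s : nat)
    (pi : bivector_field M) : set (set (bivector_field M)) :=
  [set W | exists (N : nat) (c : 'I_N -> chart_idx M) (K : 'I_N -> set M)
             (e : R),
     [/\ 0 < e,
         forall a, compact (K a) /\ K a `<=` chart_dom (chart_at (c a)) &
         forall sigma : bivector_field M,
           (forall (a : 'I_N) (p : M), K a p ->
              forall (t : seq 'I_n) (i j : 'I_n), (size t <= s)%N ->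
              let x := chart_map (chart_at (c a)) p in
              `| iter_partial t (fun y => sigma (c a) y i j) x
                 - iter_partial t (fun y => pi (c a) y i j) x | < e) ->
           W sigma]].

Definition jet_vanishes (R : realType) (n : nat) (M : smooth_manifold R n)
    (r : nat) (pi : bivector_field M) (p : M) : Prop :=
  forall (c : chart_idx M), chart_dom (chart_at c) p ->
  forall (t : seq 'I_n) (i j : 'I_n), (size t <= r)%N ->
    iter_partial t (fun y => pi c y i j) (chart_map (chart_at c) p) = 0.

Definition singularity (R : realType) (n : nat) (M : smooth_manifold R n)
    (k : nat) (pi : bivector_field M) (p : M) : Prop :=
  [/\ (0 < k)%N, jet_vanishes k.-1 pi p & ~ jet_vanishes k pi p].

(* The k-th order terms of the Taylor expansion of pi at m, on T_m M identified
   with R^n by the coordinates of the chart c. *)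
Definition homogeneous_part (R : realType) (n : nat) (M : smooth_manifold R n)
    (k : nat) (pi : bivector_field M) (c : chart_idx M) (m : M) :
    'rV[R]_n -> 'M[R]_n :=
  fun v => \matrix_(i, j)
    ((k`!%:R)^-1 * \sum_(t : k.-tuple 'I_n)
       iter_partial t (fun y => pi c y i j) (chart_map (chart_at c) m)
       * \prod_(a <- t) v 0 a).

Definition homogeneous_poly (R : realType) (n : nat) (s : int)
    (f : 'rV[R]_n -> R) : Prop :=
  match s with
  | Posz d => exists a : d.-tuple 'I_n -> R,
      forall v, f v = \sum_(t : d.-tuple 'I_n) a t * \prod_(i <- t) v 0 i
  | Negz _ => forall v, f v = 0
  end.

Definition hom_vectors (R : realType) (n : nat) (s : int) :
    set ('rV[R]_n -> 'rV[R]_n) :=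
  [set X | forall i, homogeneous_poly s (fun v => X v 0 i)].

Definition hom_bivectors (R : realType) (n : nat) (s : int) :
    set ('rV[R]_n -> 'M[R]_n) :=
  [set A | (forall v, (A v)^T = - A v) /\
           forall i j, homogeneous_poly s (fun v => A v i j)].

Definition LP_ker (R : realType) (n : nat) (P : 'rV[R]_n -> 'M[R]_n) (s : int) :
    set ('rV[R]_n -> 'M[R]_n) :=
  [set A | @hom_bivectors R n s A /\
           forall i j l v, schouten22 P A i j l v = 0].

Definition LP_im (R : realType) (n : nat) (P : 'rV[R]_n -> 'M[R]_n) (k : nat)
    (s : int) : set ('rV[R]_n -> 'M[R]_n) :=
  schouten21 P @` @hom_vectors R n (s - k%:Z + 1).

Definition LP_class (R : realType) (n : nat) (P : 'rV[R]_n -> 'M[R]_n) (k : nat)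
    (s : int) (A : 'rV[R]_n -> 'M[R]_n) : set ('rV[R]_n -> 'M[R]_n) :=
  [set B | LP_im P k s (B - A)].

(* H^{2,s}_LP(P) as the set of cosets of LP_im in LP_ker. *)
Definition H2LP (R : realType) (n : nat) (P : 'rV[R]_n -> 'M[R]_n) (k : nat)
    (s : int) : set (set ('rV[R]_n -> 'M[R]_n)) :=
  LP_class P k s @` LP_ker P s.

Definition stable_singularity (R : realType) (n : nat) (M : smooth_manifold R n)
    (k s : nat) (pi : bivector_field M) (m : M) : Prop :=
  forall Omega : set M, nbhs m Omega ->
  exists2 W : set (bivector_field M), Cs_nbhs s pi W &
    forall sigma : bivector_field M, poisson sigma -> W sigma ->
      exists2 p : M, Omega p & singularity k sigma p.

(* Main.v *)
Require Import Defs.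
From HB Require Import structures.
From mathcomp Require Import all_boot all_order all_algebra.
From mathcomp Require Import all_classical all_reals all_analysis.
From mathcomp Require Import ring lra zify.
Set Implicit Arguments.
Unset Strict Implicit.
Unset Printing Implicit Defensive.
Import Order.TTheory GRing.Theory Num.Theory.
Import numFieldNormedType.Exports.
Local Open Scope classical_set_scope.
Local Open Scope ring_scope.

(** Let x0 be the coordinates of m, a the jet of pi at x0 (zero in order < k), and
    let sigma be a Poisson structure close to pi.  Write G(x) for the jet of order
    < k of sigma at x: one looks for a zero of G near x0.

    Differentiating the Jacobi identity [sigma, sigma] = 0 up to order 2k - 2 with
    the Leibniz rule gives bilinear relations on the jet of sigma at x; since the
    orders of the two factors add up to less than 2k, each product has a factor of
    order < k.  Hence G(x) satisfies the linear equation [a, tau] = 0 up to an error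
    that is small with respect to its norm ([jet_bracket_trunc]).  By induction on
    the order s < k, the vanishing of H^{2,s} shows that a symmetric and skew
    solution tau of this equation is zero in order < k - 1, and is in order k - 1 the
    derivative of the homogeneous part along a constant vector
    ([jet_bracket_exact]); here a relation between polynomial coefficients is read on
    the derivatives at the origin, Euler's identity showing that a homogeneous
    function of degree d is determined by those of order d ([euler_eq0]).  So the
    solutions lie in the image of D, the derivative at x0 of the jet map of pi.

    Choose A with D A D = D.  As sigma is close to pi, G is almost affine with
    linear part D and G(x0) is small, so a contraction argument yields x near x0
    with G(x) A = 0 ([almost_affine_zero]).  The rows killed by A meet the image
    of D only at 0, so the linear equation, even satisfied with such
    an error, forces G(x) = 0 ([linear_system_bound],
    [local_stability]).  The k-jet of sigma at x is close to a, hence not zero, and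
    the vanishing of a jet does not depend on the chart ([jet_vanishes_in_chart]). *)

(** * Partial derivatives *)

(** Differentiability is local: the differential of f at x still expands any g that
    agrees with f near x. *)
Lemma near_eq_diff_expansion (R : numFieldType) (V W : normedModType R)
    (f g : V -> W) (x : V) :
  (\near x, f x = g x) -> differentiable f x ->
  g \o shift x = cst (g x) + 'd f x +o_ 0 id.
Proof.
move=> fg df; apply/eqaddoP => _/posnumP[e].
have /eqaddoP/(_ e%:num (gt0 e)) := diff_locally df.
have fg0 : \forall h \near (0 : V), f (h + x) = g (h + x).
  by move: fg; rewrite (near_shift 0)/=; apply: filterS => h /=; rewrite subr0.
have fgx := nbhs_singleton fg.
apply: filterS2 fg0 => h /= fgh.
by rewrite !fctE /= fgh fgx.
Qed.

Lemma near_eq_differentiable (R : numFieldType) (V W : normedModType R)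
    (f g : V -> W) (x : V) :
  (\near x, f x = g x) -> differentiable f x -> differentiable g x.
Proof.
move=> fg df; have fgE := near_eq_diff_expansion fg df.
apply/diff_locallyP.
have dE := diff_unique (diff_continuous df) fgE.
split; first by rewrite dE; exact: diff_continuous.
by rewrite dE.
Qed.

Section Calculus.
Variables (R : realType) (n : nat).
Implicit Types (f g : 'rV[R]_n -> R) (U : set 'rV[R]_n) (x v : 'rV[R]_n).

Lemma partial_near_eq i f g x :
  (\near x, f x = g x) -> partial i f x = partial i g x.
Proof. exact: near_eq_derive. Qed.

Lemma near_open U (P : 'rV[R]_n -> Prop) x : open U -> U x ->
  (forall y, U y -> P y) -> \near x, P x.
Proof.
by move=> oU Ux UP; apply: filterS (open_nbhs_nbhs (conj oU Ux)) => y /UP.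
Qed.

Lemma iter_partial_eq U s f g : open U -> (forall x, U x -> f x = g x) ->
  forall x, U x -> iter_partial s f x = iter_partial s g x.
Proof.
move=> oU fg; elim: s => [//|i s IHs] x Ux /=.
by apply: partial_near_eq; exact: (near_open oU Ux IHs).
Qed.

Lemma iter_partial_cat s t f :
  iter_partial (s ++ t) f = iter_partial s (iter_partial t f).
Proof. by rewrite /iter_partial foldr_cat. Qed.

Lemma smooth_on_sub U V f : V `<=` U -> smooth_on U f -> smooth_on V f.
Proof. by move=> VU sf s x /VU; exact: sf. Qed.

Lemma smooth_on_iter U s f : smooth_on U f -> smooth_on U (iter_partial s f).
Proof. by move=> sf t x Ux; rewrite -iter_partial_cat; exact: sf. Qed.

Lemma smooth_on_partial U i f : smooth_on U f -> smooth_on U (partial i f).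
Proof. exact: (@smooth_on_iter U [:: i]). Qed.

Lemma smooth_on_diff U f x : smooth_on U f -> U x -> differentiable f x.
Proof. by move=> sf; exact: (sf [::]). Qed.

(** Smoothness may be checked on the first derivatives: the innermost derivative of
    an iterated one is split off. *)
Lemma smooth_onP U f : (forall x, U x -> differentiable f x) ->
  (forall i, smooth_on U (partial i f)) -> smooth_on U f.
Proof.
move=> df spf s; case/lastP: s => [|s i] x Ux; first exact: df.
by rewrite -cats1 iter_partial_cat; exact: spf.
Qed.

Lemma partialD i f g x : differentiable f x -> differentiable g x ->
  partial i (fun y => f y + g y) x = partial i f x + partial i g x.
Proof. by move=> df dg; apply: deriveD; exact: diff_derivable. Qed.

Lemma partialM i f g x : differentiable f x -> differentiable g x ->
  partial i (fun y => f y * g y) x = partial i f x * g x + f x * partial i g x.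
Proof.
move=> df dg; rewrite /partial.
rewrite -[LHS]/('D_(delta_mx 0 i) (f * g) x) deriveM; try exact: diff_derivable.
by rewrite addrC; congr (_ + _); exact: mulrC.
Qed.

Lemma partial_cst i (a : R) x : partial i (fun=> a) x = 0.
Proof. exact: derive_cst. Qed.

Lemma partialZ i (a : R) f x : differentiable f x ->
  partial i (fun y => a * f y) x = a * partial i f x.
Proof.
move=> df; have dc : differentiable (fun _ : 'rV[R]_n => a) x.
  exact: differentiable_cst.
by rewrite partialM// partial_cst mul0r add0r.
Qed.

Lemma differentiable_bigsum (I : Type) (r : seq I) (F : I -> 'rV[R]_n -> R) x :
  (forall a, differentiable (F a) x) ->
  differentiable (fun y => \sum_(a <- r) F a y) x.
Proof.
move=> dF; elim: r => [|a r IHr].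
  by under eq_fun do rewrite big_nil; exact: differentiable_cst.
by under eq_fun do rewrite big_cons; exact: differentiableD.
Qed.

Lemma partial_sum i (I : Type) (r : seq I) (F : I -> 'rV[R]_n -> R) x :
  (forall a, differentiable (F a) x) ->
  partial i (fun y => \sum_(a <- r) F a y) x = \sum_(a <- r) partial i (F a) x.
Proof.
move=> dF; elim: r => [|a r IHr].
  by under eq_fun do rewrite big_nil; rewrite partial_cst big_nil.
under eq_fun do rewrite big_cons.
by rewrite partialD ?big_cons ?IHr//; exact: differentiable_bigsum.
Qed.

Lemma derive_coord j x v : 'D_v (fun y : 'rV[R]_n => y 0 j) x = v 0 j.
Proof.
have /matrixP/(_ 0 j) := derive_mx (@derivable_id _ _ x v).
by rewrite derive_id mxE.
Qed.

Lemma partial_coord i j x :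
  partial i (fun y : 'rV[R]_n => y 0 j) x = (i == j)%:R.
Proof. by rewrite /partial derive_coord mxE eqxx eq_sym. Qed.

Lemma derive_partial f x v : differentiable f x ->
  'D_v f x = \sum_i v 0 i * partial i f x.
Proof.
move=> df; rewrite deriveE// {1}(row_sum_delta v) linear_sum.
by apply: eq_bigr => i _; rewrite linearZ /partial deriveE.
Qed.

(** Derivative of the restriction of f to a line. *)
Lemma is_derive_line f x v (t : R) : differentiable f (x + t *: v) ->
  is_derive t 1 (fun s => f (x + s *: v)) ('D_v f (x + t *: v)).
Proof.
move=> df; have dv := @diff_derivable _ _ _ _ _ v df.
have E : (fun h : R => h^-1 *: (f (x + (h *: (1 : R) + t) *: v) - f (x + t *: v)))
   = (fun h => h^-1 *: (f (h *: v + (x + t *: v)) - f (x + t *: v))).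
  by apply/funext => h; rewrite [h *: 1]mulr1 scalerDl addrCA.
by split; rewrite /derivable /derive E.
Qed.

End Calculus.

(** * Symmetry of second derivatives *)

Section Calculus2.
Variables (R : realType) (n : nat).
Implicit Types (f g : 'rV[R]_n -> R) (U : set 'rV[R]_n) (x v w : 'rV[R]_n).

(** The second difference of f over the parallelogram spanned by h v and h w is h^2
    times a mixed second derivative at one of its points: the mean value theorem
    is applied twice. *)
Lemma second_difference f U x v w (h : R) : 0 < h ->
  (forall s t : R, 0 <= s <= h -> 0 <= t <= h -> U (x + s *: v + t *: w)) ->
  (forall y, U y -> differentiable f y) ->
  (forall y, U y -> differentiable ('D_v f) y) ->
  exists y : 'rV[R]_n, exists s t : R,
  [/\ y = x + s *: v + t *: w, 0 <= s <= h, 0 <= t <= h &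
    f (x + h *: v + h *: w) - f (x + h *: v) - f (x + h *: w) + f x
    = h * h * 'D_w ('D_v f) y].
Proof.
move=> h0 Uxh df ddf.
have hh : 0 <= h <= h by rewrite lexx ltW.
have h00 : 0 <= (0 : R) <= h by rewrite lexx ltW.
have U0 s : 0 <= s <= h -> U (x + s *: v).
  by move=> hs; have := Uxh s 0 hs h00; rewrite scale0r addr0.
have Uh s : 0 <= s <= h -> U (x + h *: w + s *: v).
  by move=> hs; rewrite addrAC; exact: Uxh.
pose phi (s : R) : R := f (x + h *: w + s *: v) - f (x + s *: v).
have dphi s : 0 <= s <= h -> is_derive s 1 phi
    ('D_v f (x + h *: w + s *: v) - 'D_v f (x + s *: v)).
  move=> hs; apply: is_deriveB.
    by apply: is_derive_line; exact/df/Uh.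
  by apply: is_derive_line; exact/df/U0.
have [||s sh] := @MVT R phi
    (fun s => 'D_v f (x + h *: w + s *: v) - 'D_v f (x + s *: v)) 0 h h0.
- by move=> s /[!in_itv]/= /andP[s0 sh]; apply: dphi; rewrite !ltW.
- apply: derivable_within_continuous => s /[!in_itv]/= sh.
  by have [] := dphi s sh.
have {}sh : 0 <= s <= h by move: sh; rewrite in_itv/= => /andP[? ?]; rewrite !ltW.
rewrite subr0 => phiE.
have dpsi t : 0 <= t <= h -> is_derive t 1 (fun t : R => 'D_v f (x + s *: v + t *: w))
    ('D_w ('D_v f) (x + s *: v + t *: w)).
  by move=> th; apply: is_derive_line; exact/ddf/Uxh.
have [||t th] := @MVT R (fun t : R => 'D_v f (x + s *: v + t *: w))
    (fun t : R => 'D_w ('D_v f) (x + s *: v + t *: w)) 0 h h0.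
- by move=> t /[!in_itv]/= /andP[t0 th]; apply: dpsi; rewrite !ltW.
- apply: derivable_within_continuous => t /[!in_itv]/= th.
  by have [] := dpsi t th.
have {}th : 0 <= t <= h by move: th; rewrite in_itv/= => /andP[? ?]; rewrite !ltW.
rewrite subr0 scale0r addr0 => psiE.
exists (x + s *: v + t *: w), s, t; split=> //.
rewrite -mulrA [h * 'D_w _ _]mulrC -psiE [x + s *: v + _]addrAC mulrC -phiE /phi.
rewrite !scale0r !addr0 [x + h *: w + _]addrAC opprB.
by rewrite addrA addrAC.
Qed.

(** Equality of mixed partial derivatives.  Taken at suitable points close to x, both
    equal the same second difference divided by h^2, and both are continuous at x. *)
Lemma partialC U f i j x : open U -> smooth_on U f -> U x ->
  partial i (partial j f) x = partial j (partial i f) x.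
Proof.
move=> oU sf Ux; apply/eqP; rewrite -subr_eq0; apply/negPn/negP => ne0.
set a := partial i (partial j f) x; set b := partial j (partial i f) x.
pose e : R := `|a - b| / 2.
have e0 : 0 < e by rewrite divr_gt0// normr_gt0.
have cont k l : \forall y \near x,
    `|partial k (partial l f) x - partial k (partial l f) y| < e.
  have := differentiable_continuous (sf [:: k; l] x Ux).
  by move=> /cvgrPdist_lt/(_ e e0).
have ca := cont i j; rewrite -/a in ca.
have cb := cont j i; rewrite -/b in cb.
have Fx := nbhs_filter x.
have near_x := filterI (open_nbhs_nbhs (conj oU Ux)) (filterI ca cb).
have [r r0 xr] := (nbhs_ballP _ _).1 (near_x Fx Fx).
pose v : 'rV[R]_n := delta_mx 0 j; pose w : 'rV[R]_n := delta_mx 0 i.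
pose h := r / (1 + `|v| + `|w|).
have d0 : 0 < 1 + `|v| + `|w| by rewrite -addrA ltr_pwDl// addr_ge0.
have h0 : 0 < h by rewrite divr_gt0.
have inball (s t : R) : 0 <= s <= h -> 0 <= t <= h ->
    ball x r (x + s *: v + t *: w).
  move=> /andP[s0 sh] /andP[t0 th]; rewrite -ball_normE /ball_/=.
  rewrite -addrA opprD addNKr normrN.
  rewrite (le_lt_trans (ler_normD _ _)) // !normrZ (ger0_norm s0) (ger0_norm t0).
  rewrite (@le_lt_trans _ _ (h * (`|v| + `|w|)))//.
    by rewrite mulrDr lerD// ler_wpM2r.
  by rewrite /h mulrAC ltr_pdivrMr// ltr_pM2l// -addrA ltrDr.
have inball' (s t : R) : 0 <= s <= h -> 0 <= t <= h ->
    ball x r (x + s *: w + t *: v).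
  by move=> sh th; rewrite addrAC; exact: inball.
have dU y : ball x r y -> differentiable f y.
  by move=> /xr[Uy _]; exact: smooth_on_diff Uy.
have dpU k y : ball x r y -> differentiable (partial k f) y.
  by move=> /xr[Uy _]; exact: (sf [:: k]).
have [y [s [t [yE sh th Dy]]]] := second_difference h0 inball dU (dpU j).
have [z [s' [t' [zE sh' th' Dz]]]] := second_difference h0 inball' dU (dpU i).
have eqyz : partial i (partial j f) y = partial j (partial i f) z.
  have hh0 : h * h != 0 by rewrite mulf_neq0// gt_eqF.
  apply: (mulfI hh0); rewrite -[LHS]Dy -[RHS]Dz.
  by rewrite [x + h *: v + _]addrAC; congr (_ + _); exact: addrAC.
have ry : ball x r y by rewrite yE; exact: inball.
have rz : ball x r z by rewrite zE; exact: inball'.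
have [_ [ay _]] := xr y ry.
have [_ [_ bz]] := xr z rz.
have ab : `|a - b| <= `|a - partial i (partial j f) y|
                    + `|b - partial j (partial i f) z|.
  by rewrite [X in _ <= _ + X]distrC -eqyz; exact: ler_distD.
by have := le_lt_trans ab (ltrD ay bz); rewrite /e -splitr ltxx.
Qed.

End Calculus2.

(** * Iterated derivatives of products and composites *)

(** All ways of distributing the entries of a list over two lists. *)
Fixpoint splits (T : Type) (t : seq T) : seq (seq T * seq T) :=
  if t is i :: t' then
    [seq (i :: p.1, p.2) | p <- splits t'] ++ [seq (p.1, i :: p.2) | p <- splits t']
  else [:: ([::], [::])].

Lemma size_splits (T : Type) (t : seq T) : size (splits t) = (2 ^ size t)%N.
Proof. by elim: t => //= i t IHt; rewrite size_cat !size_map IHt expnS mul2n addnn. Qed.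

Lemma splits_size (T : eqType) (t : seq T) p : p \in splits t ->
  (size p.1 + size p.2)%N = size t.
Proof.
elim: t p => [|i t IHt] p /=; first by rewrite inE => /eqP ->.
by rewrite mem_cat => /orP[] /mapP[q /IHt qt ->] /=; rewrite ?addSn ?addnS qt.
Qed.

Section Smooth.
Variables (R : realType) (n : nat).
Implicit Types (f g : 'rV[R]_n -> R) (U : set 'rV[R]_n) (x v w : 'rV[R]_n).

(** Iterated derivatives depend only on the multiset of directions. *)
Lemma iter_partial_perm U s t f x : open U -> smooth_on U f -> U x ->
  perm_eq s t -> iter_partial s f x = iter_partial t f x.
Proof.
move=> oU sf Ux.
have swap i s1 s2 : forall y, U y ->
    iter_partial (s1 ++ i :: s2) f y = iter_partial (i :: s1 ++ s2) f y.
  elim: s1 => [//|j s1 IHs1] y Uy /=.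
  rewrite (partialC _ _ oU _ Uy); last exact: smooth_on_iter.
  by apply: partial_near_eq; exact: (near_open oU Uy IHs1).
elim: s t x Ux => [|i s IHs] t x Ux; first by rewrite perm_sym => /perm_nilP->.
move=> st; have it : i \in t by rewrite -(perm_mem st) mem_head.
move: st; case/splitPr: it => t1 t2; rewrite swap//.
rewrite perm_sym -cat1s perm_catCA/= perm_cons perm_sym => st /=.
apply: partial_near_eq; apply: (near_open oU Ux) => y Uy.
exact: IHs.
Qed.

Lemma smooth_on_cst U (a : R) : smooth_on U (fun=> a).
Proof.
have H s : exists b : R, iter_partial s (fun=> a) = (fun=> b) :> ('rV[R]_n -> R).
  elim: s => [|i s [b /= ->]]; first by exists a.
  by exists 0; apply/funext => y; rewrite partial_cst.
by move=> s x Ux; have [b ->] := H s; exact: differentiable_cst.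
Qed.

Lemma smooth_on_coord U j : smooth_on U (fun y : 'rV[R]_n => y 0 j).
Proof.
apply: smooth_onP => [x Ux|i]; first exact: differentiable_coord.
have -> : partial i (fun y : 'rV[R]_n => y 0 j) = (fun=> (i == j)%:R).
  by apply/funext => y; rewrite partial_coord.
exact: smooth_on_cst.
Qed.

Lemma iter_partial_sum U s (I : Type) (r : seq I) (F : I -> 'rV[R]_n -> R) :
  open U -> (forall a, smooth_on U (F a)) -> forall x, U x ->
  iter_partial s (fun y => \sum_(a <- r) F a y) x
  = \sum_(a <- r) iter_partial s (F a) x.
Proof.
move=> oU sF; elim: s => [//|i s IHs] x Ux /=.
rewrite (partial_near_eq _ (near_open oU Ux IHs)) partial_sum// => a.
exact: sF.
Qed.

Lemma smooth_on_sum U (I : Type) (r : seq I) (F : I -> 'rV[R]_n -> R) :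
  open U -> (forall a, smooth_on U (F a)) ->
  smooth_on U (fun y => \sum_(a <- r) F a y).
Proof.
move=> oU sF s x Ux.
have E y : U y -> \sum_(a <- r) iter_partial s (F a) y
    = iter_partial s (fun y => \sum_(a <- r) F a y) y.
  by move=> Uy; rewrite (@iter_partial_sum U).
apply: near_eq_differentiable (near_open oU Ux E) _.
by apply: differentiable_bigsum => a; exact: sF.
Qed.

Lemma iter_partialD U s f g : open U -> smooth_on U f -> smooth_on U g ->
  forall x, U x ->
  iter_partial s (fun y => f y + g y) x = iter_partial s f x + iter_partial s g x.
Proof.
move=> oU sf sg; elim: s => [//|i s IHs] x Ux /=.
rewrite (partial_near_eq _ (near_open oU Ux IHs)) partialD//; [exact: sf|exact: sg].
Qed.

Lemma smooth_onD U f g : open U -> smooth_on U f -> smooth_on U g ->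
  smooth_on U (fun y => f y + g y).
Proof.
move=> oU sf sg s x Ux.
have E y : U y -> iter_partial s f y + iter_partial s g y
    = iter_partial s (fun y => f y + g y) y.
  by move=> Uy; rewrite (@iter_partialD U).
by apply: near_eq_differentiable (near_open oU Ux E) _; apply: differentiableD;
  [exact: sf|exact: sg].
Qed.

(** The Leibniz rule for iterated partial derivatives. *)
Lemma iter_partialM U s f g : open U -> smooth_on U f -> smooth_on U g ->
  forall x, U x ->
  iter_partial s (fun y => f y * g y) x
  = \sum_(p <- splits s) iter_partial p.1 f x * iter_partial p.2 g x.
Proof.
move=> oU sf sg; elim: s => [|i s IHs] x Ux /=; first by rewrite big_seq1.
rewrite (partial_near_eq _ (near_open oU Ux IHs)) partial_sum; last first.
  by move=> p; apply: differentiableM; [exact: sf|exact: sg].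
rewrite big_cat !big_map /= -big_split /=; apply: eq_bigr => p _.
by rewrite partialM//; [exact: sf|exact: sg].
Qed.

Lemma smooth_onM U f g : open U -> smooth_on U f -> smooth_on U g ->
  smooth_on U (fun y => f y * g y).
Proof.
move=> oU sf sg s x Ux.
have E y : U y -> \sum_(p <- splits s) iter_partial p.1 f y * iter_partial p.2 g y
    = iter_partial s (fun y => f y * g y) y.
  by move=> Uy; rewrite (@iter_partialM U).
apply: near_eq_differentiable (near_open oU Ux E) _.
apply: differentiable_bigsum => p.
by apply: differentiableM; [exact: sf|exact: sg].
Qed.

Lemma iter_partialZ U s f (a : R) : open U -> smooth_on U f -> forall x, U x ->
  iter_partial s (fun y => a * f y) x = a * iter_partial s f x.
Proof.
move=> oU sf; elim: s => [//|i s IHs] x Ux /=.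
rewrite (partial_near_eq _ (near_open oU Ux IHs)) partialZ//; exact: sf.
Qed.

Lemma differentiable_row (p : 'rV[R]_n -> 'rV[R]_n) x :
  (forall j, differentiable (fun y => p y 0 j) x) -> differentiable p x.
Proof.
move=> dp.
have -> : p = \sum_(j < n) (fun y => p y 0 j *: (delta_mx 0 j : 'rV[R]_n)).
  by apply/funext => y; rewrite fct_sumE [LHS]row_sum_delta.
by apply: differentiable_sum => j; exact: differentiableZl.
Qed.

Lemma partial_comp i f (p : 'rV[R]_n -> 'rV[R]_n) x :
  (forall j, differentiable (fun y => p y 0 j) x) -> differentiable f (p x) ->
  partial i (fun y => f (p y)) x
  = \sum_j partial j f (p x) * partial i (fun y => p y 0 j) x.
Proof.
move=> dp df; have dpx := differentiable_row dp.
rewrite /partial -[LHS]/('D_(delta_mx 0 i) (f \o p) x).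
rewrite deriveE; last exact: differentiable_comp.
rewrite diff_comp//= -!deriveE// derive_partial//.
apply: eq_bigr => j _; rewrite mulrC derive_mx ?mxE//; exact: diff_derivable.
Qed.

(** A qualitative chain rule of higher order: a derivative of a composite is a combination,
    with smooth coefficients, of derivatives of no higher order of the outer map. *)
Lemma iter_partial_comp U V f (p : 'rV[R]_n -> 'rV[R]_n) s :
  open U -> smooth_on V f -> (forall j, smooth_on U (fun y => p y 0 j)) ->
  (forall x, U x -> V (p x)) ->
  exists (I : finType) (q : I -> seq 'I_n) (h : I -> 'rV[R]_n -> R),
    (forall a, (size (q a) <= size s)%N /\ smooth_on U (h a)) /\
    forall x, U x -> iter_partial s (fun y => f (p y)) x
      = \sum_a iter_partial (q a) f (p x) * h a x.
Proof.
move=> oU sf sp pU; elim: s => [|i s [I [q [h [qh IHs]]]]].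
  exists unit, (fun=> [::]), (fun=> fun=> 1); split.
    by move=> a; split=> //; exact: smooth_on_cst.
  by move=> x Ux; rewrite big_const card_unit /= addr0 mulr1.
have sh a : smooth_on U (h a) by have [] := qh a.
exists ((I * 'I_n) + I)%type,
  (fun a => match a with inl b => b.2 :: q b.1 | inr b => q b end),
  (fun a => match a with
            | inl b => fun x => partial i (fun y => p y 0 b.2) x * h b.1 x
            | inr b => partial i (h b) end); split.
  move=> [[a j]|a] /=; have [sq _] := qh a.
    by split=> //; apply: smooth_onM => //; exact: smooth_on_partial.
  by split; [exact: leqW|exact: smooth_on_partial].
move=> x Ux /=; rewrite (partial_near_eq _ (near_open oU Ux IHs)).
have dp j : differentiable (fun y => p y 0 j) x by exact: smooth_on_diff (sp j) Ux.
have dq a : differentiable (iter_partial (q a) f) (p x) by apply: sf; exact: pU.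
have dqp a : differentiable (fun y => iter_partial (q a) f (p y)) x.
  by apply: differentiable_comp => //; exact: differentiable_row.
have dh a : differentiable (h a) x by exact: smooth_on_diff (sh a) Ux.
rewrite partial_sum; last by move=> a; exact: differentiableM.
rewrite big_sumType /= -(pair_bigA _ (fun a j =>
  partial j (iter_partial (q a) f) (p x)
  * (partial i (fun y => p y 0 j) x * h a x))) /=.
rewrite -big_split; apply: eq_bigr => a _ /=.
rewrite partialM// partial_comp// mulr_suml; congr (_ + _).
by apply: eq_bigr => j _; rewrite mulrA.
Qed.

(** The vanishing at a point of all derivatives up to order r is inherited by
    composites and, below, by products. *)
Lemma flat_comp U V f (p : 'rV[R]_n -> 'rV[R]_n) r x :
  open U -> smooth_on V f -> (forall j, smooth_on U (fun y => p y 0 j)) ->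
  (forall x, U x -> V (p x)) -> U x ->
  (forall t, (size t <= r)%N -> iter_partial t f (p x) = 0) ->
  forall t, (size t <= r)%N -> iter_partial t (fun y => f (p y)) x = 0.
Proof.
move=> oU sf sp pU Ux f0 t tr.
have [I [q [h [qh E]]]] := iter_partial_comp t oU sf sp pU.
rewrite E// big1// => a _; have [qt _] := qh a.
by rewrite f0 ?mul0r// (leq_trans qt).
Qed.

Lemma flatM U f g r x : open U -> smooth_on U f -> smooth_on U g -> U x ->
  (forall t, (size t <= r)%N -> iter_partial t g x = 0) ->
  forall t, (size t <= r)%N -> iter_partial t (fun y => f y * g y) x = 0.
Proof.
move=> oU sf sg Ux g0 t tr; rewrite (@iter_partialM U)// big_seq big1// => p pt.
by rewrite g0 ?mulr0// (leq_trans _ tr)// -(splits_size pt) leq_addl.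
Qed.

End Smooth.

(** * Homogeneous polynomials and Euler's identity *)

Section Homogeneous.
Variables (R : realType) (n : nat).
Implicit Types (f g : 'rV[R]_n -> R) (x v w : 'rV[R]_n) (a b : seq 'I_n -> R).

(** The form of degree d with coefficients a (i_1, ..., i_d), the sum of
    a (i_1, ..., i_d) v_{i_1} ... v_{i_d} over all words; the recursion on d makes it
    easy to differentiate. *)
Fixpoint form (d : nat) (a : seq 'I_n -> R) (v : 'rV[R]_n) : R :=
  if d is d'.+1 then \sum_i v 0 i * form d' (fun s => a (i :: s)) v
  else a [::].

(** The symmetry that equality of mixed derivatives imposes on a family indexed by
    words. *)
Definition jet_sym (a : seq 'I_n -> R) := forall s t, perm_eq s t -> a s = a t.

Lemma formE d a v :
  form d a v = \sum_(t : d.-tuple 'I_n) a t * \prod_(i <- t) v 0 i.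
Proof.
elim: d a => [|d IHd] a /=.
  rewrite (big_pred1 [tuple]) => [|t]; first by rewrite big_nil mulr1.
  by apply/esym/eqP; exact: tuple0.
rewrite (reindex (fun p : 'I_n * d.-tuple 'I_n => [tuple of p.1 :: p.2])) /=.
  rewrite -(pair_bigA _ (fun i (t : d.-tuple 'I_n) =>
    a (i :: t) * \prod_(j <- i :: t) v 0 j)) /=.
  apply: eq_bigr => i _; rewrite IHd mulr_sumr; apply: eq_bigr => t _.
  by rewrite big_cons mulrCA.
exists (fun t => (thead t, [tuple of behead t])) => [[i t] _|t _] /=.
  by congr (_, _); apply: val_inj.
by rewrite -tuple_eta.
Qed.

Lemma smooth_on_form d a : smooth_on setT (form d a).
Proof.
elim: d a => [|d IHd] a /=; first exact: smooth_on_cst.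
apply: smooth_on_sum => [|i]; first exact: openT.
exact: (smooth_onM openT (smooth_on_coord _) (IHd _)).
Qed.

(** For symmetric coefficients, the terms where the derivative falls on one of the d+1
    variables are all equal. *)
Lemma partial_form d a h : jet_sym a ->
  partial h (form d.+1 a) = fun v => d.+1%:R * form d (fun s => a (h :: s)) v.
Proof.
elim: d a => [|d IHd] a sa; apply/funext => v.
  have dc (i : 'I_n) : differentiable (fun w : 'rV[R]_n => w 0 i) v.
    exact: differentiable_coord.
  have dk (b : R) : differentiable (fun _ : 'rV[R]_n => b) v.
    exact: differentiable_cst.
  rewrite /= partial_sum => [|i]; last exact: differentiableM.
  under eq_bigr do rewrite partialM// partial_coord partial_cst mulr0 addr0.
  rewrite (bigD1 h)//= big1 ?addr0 ?eqxx// => i ih.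
  by rewrite eq_sym (negbTE ih) mul0r.
have df (i : 'I_n) : differentiable (form d.+1 (fun s => a (i :: s))) v.
  exact: (smooth_on_diff (smooth_on_form _ _)).
have dc (i : 'I_n) : differentiable (fun w : 'rV[R]_n => w 0 i) v.
  exact: differentiable_coord.
have -> : form d.+2 a = fun w : 'rV[R]_n =>
  \sum_i w 0 i * form d.+1 (fun s => a (i :: s)) w by [].
rewrite partial_sum => [|i]; last exact: differentiableM.
have E (i : 'I_n) : partial h (fun w => w 0 i * form d.+1 (fun s => a (i :: s)) w) v
  = (h == i)%:R * form d.+1 (fun s => a (i :: s)) v
    + d.+1%:R * (v 0 i * form d (fun s => a (h :: i :: s)) v).
  rewrite partialM// partial_coord IHd.
    rewrite [X in _ + X]mulrCA; congr (_ + _ * (_ * form d _ v)); apply/funext => s; apply: sa.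
    by apply/permPl; exact: (perm_catCA [:: i] [:: h] s).
  by move=> s t st; apply: sa; rewrite perm_cons.
rewrite (eq_bigr _ (fun i _ => E i)) big_split /= -mulr_sumr.
rewrite (bigD1 h)//= [X in _ + X + _]big1 => [|i ih].
  rewrite addr0 eqxx mul1r.
  by rewrite -[d.+2%:R]natr1 mulrDl mul1r [RHS]addrC.
by rewrite eq_sym (negbTE ih) mul0r.
Qed.

(** The term of degree d of the Taylor series at 0 with derivatives a. *)
Definition taylor_term (d : nat) (a : seq 'I_n -> R) (v : 'rV[R]_n) : R :=
  d`!%:R^-1 * form d a v.

Lemma smooth_on_taylor d a : smooth_on setT (taylor_term d a).
Proof.
exact: (smooth_onM openT (smooth_on_cst _) (smooth_on_form _ _)).
Qed.

Lemma partial_taylor d a h : jet_sym a ->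
  partial h (taylor_term d.+1 a) = taylor_term d (fun s => a (h :: s)).
Proof.
move=> sa; apply/funext => v.
rewrite partialZ; last exact: (smooth_on_diff (smooth_on_form _ _)).
rewrite partial_form// mulrA /taylor_term; congr (_ * _).
by rewrite factS natrM invfM mulrAC mulVf ?mul1r// pnatr_eq0.
Qed.

(** A homogeneous polynomial has a as its jet at 0 in degree d, and no other
    derivative there. *)
Lemma iter_partial_taylor d a s : jet_sym a ->
  iter_partial s (taylor_term d a) 0 = if size s == d then a s else 0.
Proof.
move=> sa.
have le s' : (size s' <= d)%N -> iter_partial s' (taylor_term d a)
    = taylor_term (d - size s') (fun t => a (s' ++ t)).
  elim: s' => [|i s' IHs] /=; first by rewrite subn0.
  move=> sd; rewrite (IHs (ltnW sd)) subnS.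
  have : (0 < d - size s')%N by rewrite subn_gt0.
  case: (d - size s')%N => // e _; rewrite partial_taylor/=.
    congr taylor_term; apply/funext => t; apply: sa.
    by apply/permPl; exact: (perm_catCA s' [:: i] t).
  by move=> t u tu; apply: sa; rewrite perm_cat2l.
have [sd|ds] := leqP (size s) d.
  rewrite le// eqn_leq sd/= -subn_eq0; case: (d - size s)%N => [|e].
    by rewrite /taylor_term /= fact0 invr1 mul1r cats0.
  by rewrite /taylor_term /= big1 ?mulr0// => i _; rewrite mxE mul0r.
rewrite gtn_eqF// -[s in LHS](cat_take_drop (size s - d)) iter_partial_cat.
have sz : size (drop (size s - d) s) = d by rewrite size_drop subKn// ltnW.
rewrite le ?sz// subnn.
have : (0 < size (take (size s - d) s))%N.
  by rewrite size_takel ?leq_subr// subn_gt0.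
case/lastP: (take _ s) => [//|t i] _; rewrite -cats1 iter_partial_cat.
have -> : iter_partial [:: i] (taylor_term 0 (fun t0 => a (drop (size s - d) s ++ t0)))
    = (fun=> 0).
  apply/funext => v.
  exact: (partial_cst i (0`!%:R^-1 * a (drop (size s - d) s ++ [::])) v).
suff -> : iter_partial t (fun=> 0) = (fun=> 0) :> ('rV[R]_n -> R) by [].
elim: t => [//|j t /= ->]; apply/funext => v; exact: partial_cst.
Qed.

(** Smooth functions on R^n that are homogeneous of degree r in the sense of
    Euler's identity. *)
Definition euler (r : R) f :=
  smooth_on setT f /\ forall v, \sum_i v 0 i * partial i f v = r * f v.

Lemma euler0 r : euler r (fun=> 0).
Proof.
split=> [|v]; first exact: smooth_on_cst.
by rewrite mulr0 big1// => i _; rewrite partial_cst mulr0.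
Qed.

Lemma euler_taylor d a : jet_sym a -> euler d%:R (taylor_term d a).
Proof.
move=> sa; split=> [|v]; first exact: smooth_on_taylor.
case: d => [|d].
  have -> : taylor_term 0 a = fun=> 0`!%:R^-1 * a [::] by [].
  by rewrite mul0r big1// => i _; rewrite partial_cst mulr0.
under eq_bigr do rewrite partial_taylor//.
rewrite /taylor_term /= factS natrM invfM !mulrA divff ?pnatr_eq0// mul1r.
by rewrite mulr_sumr; apply: eq_bigr => i _; rewrite mulrCA.
Qed.

Lemma eulerD r f g : euler r f -> euler r g -> euler r (fun v => f v + g v).
Proof.
move=> [sf ef] [sg eg]; split=> [|v].
  by apply: smooth_onD => //; exact: openT.
rewrite mulrDr -ef -eg -big_split; apply: eq_bigr => i _ /=.
by rewrite partialD ?mulrDr//; [exact: smooth_on_diff sf _|exact: smooth_on_diff sg _].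
Qed.

Lemma euler_sum r (I : Type) (s : seq I) (F : I -> 'rV[R]_n -> R) :
  (forall i, euler r (F i)) -> euler r (fun v => \sum_(i <- s) F i v).
Proof.
move=> eF; elim: s => [|a s IHs].
  by under eq_fun do rewrite big_nil; exact: euler0.
by under eq_fun do rewrite big_cons; exact: eulerD.
Qed.

Lemma eulerM r q f g : euler r f -> euler q g -> euler (r + q) (fun v => f v * g v).
Proof.
move=> [sf ef] [sg eg]; split=> [|v].
  by apply: smooth_onM => //; exact: openT.
rewrite mulrDl mulrA -ef mulrCA -eg mulr_suml mulr_sumr -big_split.
apply: eq_bigr => i _ /=; rewrite partialM; last 2 first.
- exact: smooth_on_diff sf _.
- exact: smooth_on_diff sg _.
by rewrite mulrDr mulrA [v 0 i * (f v * _)]mulrCA.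
Qed.

Lemma euler_partial r f h : euler r f -> euler (r - 1) (partial h f).
Proof.
move=> [sf ef]; split=> [|v]; first exact: smooth_on_partial.
have dp i : differentiable (partial i f) v.
  exact: (smooth_on_diff (smooth_on_partial _ sf)).
have dc (i : 'I_n) : differentiable (fun w : 'rV[R]_n => w 0 i) v.
  exact: differentiable_coord.
have : partial h (fun w => \sum_i w 0 i * partial i f w) v
     = partial h (fun w => r * f w) v by congr partial; apply/funext => w.
rewrite partial_sum => [|i]; last exact: differentiableM.
rewrite partialZ; last exact: smooth_on_diff sf _.
under eq_bigr do rewrite partialM// partial_coord (partialC _ _ openT sf)//.
rewrite big_split /= (bigD1 h)//= [X in _ + X + _]big1 => [|i ih].
  by rewrite addr0 eqxx mul1r mulrBl mul1r => <-; rewrite addrC addrK.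
by rewrite eq_sym (negbTE ih) mul0r.
Qed.

(** A homogeneous function of degree d is determined by its derivatives of
    order d at the origin. *)
Lemma euler_eq0 d f : euler d%:R f ->
  (forall s, size s = d -> iter_partial s f 0 = 0) -> forall v, f v = 0.
Proof.
elim: d f => [|d IHd] f ef f0 v.
  have [sf Ef] := ef.
  have df (t : R) : is_derive t 1 (fun s : R => f (0 + s *: v)) ('D_v f (0 + t *: v)).
    by apply: is_derive_line; exact: smooth_on_diff sf _.
  have [|t t01] := @MVT R (fun s : R => f (0 + s *: v))
      (fun t : R => 'D_v f (0 + t *: v)) 0 1 ltr01.
    by apply: derivable_within_continuous => t _; have [] := df t.
  have f00 : f 0 = 0 := f0 [::] erefl.
  rewrite !add0r scale1r scale0r f00 !subr0 mulr1 => ->.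
  move: t01; rewrite in_itv/= => /andP[t0 _].
  have tn0 : t != 0 by rewrite gt_eqF.
  apply: (mulfI tn0); rewrite derive_partial; last exact: smooth_on_diff sf _.
  rewrite mulr0 mulr_sumr -[RHS](mul0r (f (t *: v))) -Ef.
  by apply: eq_bigr => i _; rewrite mxE mulrA.
have p0 i w : partial i f w = 0.
  apply: IHd => [|s sd]; first by rewrite -[d%:R](addrK 1) natr1; exact: euler_partial.
  by rewrite -(iter_partial_cat s [:: i]) f0// size_cat sd addn1.
have [_ /(_ v)] := ef; rewrite big1 => [/esym/eqP|i _]; last by rewrite p0 mulr0.
by rewrite mulf_eq0 pnatr_eq0 => /eqP.
Qed.

End Homogeneous.

(** * Almost affine maps and linear systems *)

Section RowNorm.
Variable R : realType.

Lemma rV_norm_coord n (x : 'rV[R]_n) i : `|x 0 i| <= `|x|.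
Proof.
rewrite [leRHS]/Num.norm/= mx_normrE.
exact: (le_bigmax _ (fun ij : 'I_1 * 'I_n => `|x ij.1 ij.2|) (0, i)).
Qed.

Lemma rV_norm_le n (x : 'rV[R]_n) (c : R) : 0 <= c ->
  (forall i, `|x 0 i| <= c) -> `|x| <= c.
Proof.
move=> c0 xc; rewrite /Num.norm/= mx_normrE; apply: bigmax_le => // -[i j] _ /=.
by rewrite ord1.
Qed.

Lemma rV_mulmx_bound m n (B : 'M[R]_(m, n)) :
  exists2 C : R, 0 < C & forall x : 'rV[R]_m, `|x *m B| <= C * `|x|.
Proof.
exists (1 + \sum_i \sum_j `|B i j|) => [|x].
  by rewrite ltr_pwDl// sumr_ge0// => i _; rewrite sumr_ge0.
apply: rV_norm_le => [|j].
  by rewrite mulr_ge0// addr_ge0// sumr_ge0// => i _; rewrite sumr_ge0.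
rewrite mxE (le_trans (ler_norm_sum _ _ _))//.
apply: (@le_trans _ _ (\sum_i `|B i j| * `|x|)).
  by apply: ler_sum => i _; rewrite normrM mulrC ler_wpM2l// rV_norm_coord.
rewrite -mulr_suml ler_wpM2r// -[leLHS]add0r lerD//.
apply: ler_sum => i _; rewrite (bigD1 j)//= lerDl sumr_ge0//.
Qed.

Lemma closed_ball_rV_compact n (x0 : 'rV[R]_n) (r : R) :
  compact [set x : 'rV[R]_n | `|x - x0| <= r].
Proof.
apply: bounded_closed_compact.
  exists (r + `|x0|); split; first exact: num_real.
  move=> M rM x /= xr; rewrite (le_trans _ (ltW rM))//.
  by rewrite -[x](subrK x0) (le_trans (ler_normD _ _))// lerD2r.
apply: (@closed_comp _ _ (fun x : 'rV[R]_n => `|x - x0|) [set t | t <= r]).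
  move=> x _; apply: continuous_comp; last exact: norm_continuous.
  by apply: continuousB => //; exact: cst_continuous.
exact: closed_le.
Qed.

(** By compactness the distance from z to T z attains its minimum on the ball, and it
    decreases when z is replaced by T z. *)
Lemma contraction_fixed_point n (T : 'rV[R]_n -> 'rV[R]_n) (r : R) : 0 < r ->
  (forall z w, `|z| <= r -> `|w| <= r -> `|T z - T w| <= 2^-1 * `|z - w|) ->
  `|T 0| <= 2^-1 * r -> exists2 z, `|z| <= r & T z = z.
Proof.
move=> r0 Tc T0.
have Tr z : `|z| <= r -> `|T z| <= r.
  move=> zr; rewrite -[T z](subrK (T 0)) (le_trans (ler_normD _ _))//.
  have := Tc z 0 zr; rewrite normr0 subr0 => /(_ (ltW r0)) Tz.
  rewrite [leRHS]splitr lerD//; last by rewrite mulrC.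
  by rewrite (le_trans Tz)// mulrC ler_wpM2r.
pose K := [set z : 'rV[R]_n | `|z - 0| <= r].
have K0 : K !=set0 by exists 0; rewrite /K /= subr0 normr0 ltW.
have cF : {within K, continuous (fun z => `|z - T z|)}.
  apply/subspace_continuousP => z Kz; apply/cvgrPdist_lt => e e0.
  rewrite near_withinE; near=> w => Kw.
  have Kz' : `|z| <= r by move: Kz; rewrite /K/= subr0.
  have Kw' : `|w| <= r by move: Kw; rewrite /K/= subr0.
  rewrite (le_lt_trans (ler_dist_dist _ _))//.
  have -> : z - T z - (w - T w) = (z - w) - (T z - T w).
    by rewrite !opprB addrACA [RHS]addrACA [- T z - w]addrC.
  rewrite (le_lt_trans (ler_normB _ _))//.
  rewrite (@le_lt_trans _ _ (2 * `|z - w|))//.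
    rewrite mulr_natl mulr2n lerD// (le_trans (Tc _ _ Kz' Kw'))//.
    by rewrite ler_piMl// invf_le1// ler1n.
  rewrite mulrC -ltr_pdivlMr//; near: w; apply: cvgr_dist_lt => //.
  by rewrite divr_gt0.
have [z zK zmin] := @compact_EVT_min _ _ _ K K0 (@closed_ball_rV_compact _ 0 r) cF.
have zr : `|z| <= r by move: zK; rewrite inE /K/= subr0.
exists z => //; apply/eqP; rewrite -subr_eq0 -normr_eq0 distrC.
have : `|z - T z| <= 2^-1 * `|z - T z|.
  by apply: le_trans (Tc _ _ zr (Tr _ zr)); apply: zmin; rewrite inE /K/= subr0 Tr.
by have := normr_ge0 (z - T z); lra.
Unshelve. all: by end_near. Qed.

(** A map into R^N that is almost affine with linear part D on a ball, and almost zero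
    at the centre, takes on this ball a value killed by A, a pseudo-inverse of D. *)
Lemma almost_affine_zero n N (D : 'M[R]_(n, N)) :
  exists2 A : 'M[R]_(N, n), D *m A *m D = D &
  exists2 kappa : R, 0 < kappa &
  forall (rho : R) (x0 : 'rV[R]_n) (G : 'rV[R]_n -> 'rV[R]_N), 0 < rho ->
    (forall x y, `|x - x0| <= rho -> `|y - x0| <= rho ->
       `|G x - G y - (x - y) *m D| <= kappa * `|x - y|) ->
    `|G x0| <= kappa * rho ->
    exists2 x, `|x - x0| <= rho & G x *m A = 0.
Proof.
have [P DPD] : exists P, D *m P *m D = D.
  by exists (pinvmx D); exact/mulmxKpV/submx_refl.
have [A [E [DAE EED AE DE]]] : exists (A : 'M[R]_(N, n)) (E : 'M[R]_n),
    [/\ (D *m A = E), (E *m E = E), (A *m E = A) & (E *m D = D)].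
  exists (P *m D *m P), (D *m P); rewrite !mulmxA DPD; split=> //.
  by rewrite -!mulmxA (mulmxA D P (D *m P)) (mulmxA (D *m P) D P) DPD.
exists A; first by rewrite DAE.
have [CA CA0 CAP] := rV_mulmx_bound A.
have [CE CE0 CEP] := rV_mulmx_bound E.
exists ((2 * CA * CE)^-1) => [|rho x0 G rho0 Gaff G0].
  by rewrite invr_gt0 !mulr_gt0.
(* E = DA is idempotent with AE = A, so the linear parts cancel in T z - T w, and a
   fixed point z of T lies in the image of E. *)
pose T z : 'rV[R]_n := z *m E - G (x0 + z *m E) *m A.
pose r := rho / CE.
have r0 : 0 < r by rewrite divr_gt0.
have inball z : `|z| <= r -> `|x0 + z *m E - x0| <= rho.
  move=> zr; rewrite addrC addKr (le_trans (CEP z))// mulrC -ler_pdivlMr//.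
have Tc z w : `|z| <= r -> `|w| <= r -> `|T z - T w| <= 2^-1 * `|z - w|.
  move=> zr wr; set x := x0 + z *m E; set y := x0 + w *m E.
  have xy : x - y = (z - w) *m E.
    by rewrite /x /y mulmxBl opprD addrACA subrr add0r.
  have -> : T z - T w = - ((G x - G y - (x - y) *m D) *m A).
    rewrite /T -/x -/y xy -mulmxA DE !mulmxBl -!mulmxA DAE.
    by rewrite !opprB addrACA [RHS]addrACA [- (G x *m A) - _]addrC.
  rewrite normrN (le_trans (CAP _))//.
  apply: (@le_trans _ _ (CA * ((2 * CA * CE)^-1 * (CE * `|z - w|)))).
    have /le_trans Gxy := Gaff _ _ (inball _ zr) (inball _ wr).
    apply: ler_wpM2l; first exact: ltW.
    apply: Gxy; rewrite -/x -/y xy ler_wpM2l//.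
    by rewrite invr_ge0 !mulr_ge0// ltW.
  rewrite le_eqVlt; apply/orP; left; apply/eqP; field.
  by rewrite !gt_eqF.
have [|z zr Tz] := contraction_fixed_point r0 Tc.
  rewrite /T mul0mx addr0 sub0r normrN (le_trans (CAP _))//.
  apply: (@le_trans _ _ (CA * ((2 * CA * CE)^-1 * rho))).
    by rewrite ler_wpM2l// ltW.
  rewrite le_eqVlt; apply/orP; left; apply/eqP; rewrite /r; field.
  by rewrite !gt_eqF.
exists (x0 + z *m E); first exact: inball.
have : (T z) *m E = z *m E by rewrite Tz.
rewrite /T mulmxBl -!mulmxA EED AE => /eqP.
by rewrite -subr_eq0 addrAC subrr sub0r oppr_eq0 => /eqP.
Qed.

(** A finite system of linear forms with no common zero but 0 controls the norm. *)
Lemma linear_system_bound N (W : finType) (Z : W -> 'rV[R]_N -> R) :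
  (forall w (a : R) x y, Z w (a *: x + y) = a * Z w x + Z w y) ->
  (forall x, (forall w, Z w x = 0) -> x = 0) ->
  exists2 C : R, 0 < C & forall x c, 0 <= c -> (forall w, `|Z w x| <= c) -> `|x| <= C * c.
Proof.
move=> linZ Z0.
have Z00 w : Z w 0 = 0.
  have := linZ w (-1) 0 0; rewrite scaler0 addr0 mulN1r addrC.
  by move=> ->; rewrite subrr.
pose M : 'M[R]_(N, #|W|) := \matrix_(i, j) Z (enum_val j) (delta_mx 0 i).
have ME x j : (x *m M) 0 j = Z (enum_val j) x.
  rewrite mxE [in RHS](row_sum_delta x).
  rewrite (big_morph (Z (enum_val j)) (id1 := 0) (op1 := +%R)) => [|u v|//].
    apply: eq_bigr => i _; rewrite mxE.
    by have := linZ (enum_val j) (x 0 i) (delta_mx 0 i) 0; rewrite !addr0 Z00 addr0.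
  by have := linZ (enum_val j) 1 u v; rewrite scale1r mul1r.
have free : row_free M.
  rewrite -kermx_eq0; apply/eqP/row_matrixP => i; rewrite row0; apply: Z0 => w.
  have := ME (row i (kermx M)) (enum_rank w).
  by rewrite enum_rankK -row_mul mulmx_ker row0 mxE.
have /row_freeP[B MB] := free.
have [C C0 CB] := rV_mulmx_bound B.
exists C => // x c c0 xc.
rewrite -[x]mulmx1 -MB mulmxA (le_trans (CB _))// ler_pM2l//.
by apply: rV_norm_le => // j; rewrite ME.
Qed.

End RowNorm.

(** * The Schouten bracket on jets *)

Section Bracket.
Variables (R : realType) (n : nat).

Local Notation jets := ('I_n -> 'I_n -> seq 'I_n -> R).
Implicit Types (a b : jets) (A B : 'rV[R]_n -> 'M[R]_n) (x v : 'rV[R]_n).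

(** The jet of A at x: the derivatives of its components, indexed by the words of
    all lengths. *)
Definition jet (A : 'rV[R]_n -> 'M[R]_n) (x : 'rV[R]_n) : 'I_n -> 'I_n -> seq 'I_n -> R :=
  fun i j t => iter_partial t (fun y => A y i j) x.

(** Derivatives of the sum over h of A^{ih} d_h B^{jl}, by the Leibniz rule; d_h is the
    innermost derivative, hence the last letter of the word. *)
Definition jet_half (a b : 'I_n -> 'I_n -> seq 'I_n -> R) i j l (t : seq 'I_n) : R :=
  \sum_(p <- splits t) \sum_h a i h p.1 * b j l (p.2 ++ [:: h]).

(** The jet of the Schouten bracket of two bivector fields, in terms of their jets;
    the shape is that of [schouten22]. *)
Definition jet_bracket a b i j l t : R :=
  (jet_half a b i j l t + jet_half a b j l i t + jet_half a b l i j t)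
  + (jet_half b a i j l t + jet_half b a j l i t + jet_half b a l i j t).

Section bracket_of_fields.
Variables (U : set 'rV[R]_n) (A B : 'rV[R]_n -> 'M[R]_n).
Hypotheses (oU : open U) (sA : forall i j, smooth_on U (fun x => A x i j))
  (sB : forall i j, smooth_on U (fun x => B x i j)).

Lemma smooth_on_bracket_term (C D : 'rV[R]_n -> 'M[R]_n) i j l :
  (forall i j, smooth_on U (fun x => C x i j)) ->
  (forall i j, smooth_on U (fun x => D x i j)) ->
  smooth_on U (fun x => \sum_h C x i h * partial h (fun y => D y j l) x).
Proof.
move=> sC sD; apply: smooth_on_sum => // h.
by apply: smooth_onM => //; exact: smooth_on_partial.
Qed.

Lemma iter_partial_bracket_term (C D : 'rV[R]_n -> 'M[R]_n) i j l t x :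
  (forall i j, smooth_on U (fun x => C x i j)) ->
  (forall i j, smooth_on U (fun x => D x i j)) -> U x ->
  iter_partial t (fun x => \sum_h C x i h * partial h (fun y => D y j l) x) x
  = jet_half (jet C x) (jet D x) i j l t.
Proof.
move=> sC sD Ux; rewrite (@iter_partial_sum _ _ U)// => [|h]; last first.
  by apply: smooth_onM => //; exact: smooth_on_partial.
rewrite /jet_half exchange_big; apply: eq_bigr => h _.
rewrite (@iter_partialM _ _ U)//; last exact: smooth_on_partial.
by apply: eq_bigr => p _; rewrite /jet iter_partial_cat.
Qed.

Lemma iter_partial_schouten22 i j l t x : U x ->
  iter_partial t (schouten22 A B i j l) x = jet_bracket (jet A x) (jet B x) i j l t.
Proof.
move=> Ux; rewrite /schouten22.
do ![rewrite (@iter_partialD _ _ U)//; try by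
  [exact: smooth_on_bracket_term | apply: smooth_onD => //; exact: smooth_on_bracket_term
  |apply: smooth_onD => //; [apply: smooth_onD => //|];exact: smooth_on_bracket_term]].
by rewrite !iter_partial_bracket_term.
Qed.

End bracket_of_fields.

Lemma jet_half_linear a (c : R) b b' i j l t :
  jet_half a (fun i j t => c * b i j t + b' i j t) i j l t
  = c * jet_half a b i j l t + jet_half a b' i j l t.
Proof.
rewrite /jet_half mulr_sumr -big_split; apply: eq_bigr => p _ /=.
rewrite mulr_sumr -big_split; apply: eq_bigr => h _ /=.
by rewrite mulrDr mulrCA.
Qed.

Lemma jet_half_linearl a (c : R) b b' i j l t :
  jet_half (fun i j t => c * b i j t + b' i j t) a i j l t
  = c * jet_half b a i j l t + jet_half b' a i j l t.
Proof.
rewrite /jet_half mulr_sumr -big_split; apply: eq_bigr => p _ /=.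
rewrite mulr_sumr -big_split; apply: eq_bigr => h _ /=.
by rewrite mulrDl mulrA.
Qed.

Lemma jet_bracket_linear a (c : R) b b' i j l t :
  jet_bracket a (fun i j t => c * b i j t + b' i j t) i j l t
  = c * jet_bracket a b i j l t + jet_bracket a b' i j l t.
Proof. by rewrite /jet_bracket !jet_half_linear !jet_half_linearl; ring. Qed.

Lemma taylor_termE d (a : seq 'I_n -> R) v : taylor_term d a v
  = d`!%:R^-1 * \sum_(t : d.-tuple 'I_n) a t * \prod_(i <- t) v 0 i.
Proof. by rewrite /taylor_term formE. Qed.

(** The homogeneous bivector field of degree d whose jet at 0 is a in order d. *)
Definition taylor_bivector d a (v : 'rV[R]_n) : 'M[R]_n :=
  \matrix_(i, j) taylor_term d (a i j) v.

Lemma jet_taylor_bivector d a i j t : (forall i j, jet_sym (a i j)) ->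
  jet (taylor_bivector d a) 0 i j t = if size t == d then a i j t else 0.
Proof.
move=> sa; rewrite /jet -iter_partial_taylor//; congr (iter_partial t _ _).
by apply/funext => v; rewrite mxE.
Qed.

Lemma smooth_on_taylor_bivector d a i j :
  smooth_on setT (fun v => taylor_bivector d a v i j).
Proof.
under eq_fun do rewrite mxE; exact: smooth_on_taylor.
Qed.

Lemma hom_bivectors_taylor d a : (forall i j t, a i j t = - a j i t) ->
  hom_bivectors d%:Z (taylor_bivector d a).
Proof.
move=> ska; split=> [v|i j].
  apply/matrixP => i j; rewrite !mxE !taylor_termE -mulrN -sumrN.
  by congr (_ * _); apply: eq_bigr => t _; rewrite ska mulNr.
exists (fun t => d`!%:R^-1 * a i j t) => v; rewrite mxE taylor_termE mulr_sumr.
by apply: eq_bigr => t _; rewrite mulrA.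
Qed.

Lemma euler_bracket k s a b i j l :
  (forall i j, jet_sym (a i j)) -> (forall i j, jet_sym (b i j)) ->
  euler (k%:R + (s%:R - 1))
    (schouten22 (taylor_bivector k a) (taylor_bivector s b) i j l).
Proof.
move=> sa sb.
have E d (c : jets) i' j' : (fun v => taylor_bivector d c v i' j') = taylor_term d (c i' j').
  by apply/funext => v; rewrite mxE.
have T p q (c d : jets) i' j' l' : (forall i j, jet_sym (c i j)) -> (forall i j, jet_sym (d i j)) ->
  euler (p%:R + (q%:R - 1)) (fun v => \sum_h taylor_bivector p c v i' h *
    partial h (fun y => taylor_bivector q d y j' l') v).
  move=> sc sd; apply: euler_sum => h; apply: eulerM.
    by rewrite E; exact: euler_taylor.
  by rewrite E; apply: euler_partial; exact: euler_taylor.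
have T' i' j' l' : euler (k%:R + (s%:R - 1)) (fun v => \sum_h taylor_bivector s b v i' h *
    partial h (fun y => taylor_bivector k a y j' l') v).
  have -> : k%:R + (s%:R - 1) = s%:R + (k%:R - 1) :> R by rewrite addrCA.
  exact: T.
by apply: eulerD; (apply: eulerD; first apply: eulerD); auto.
Qed.

(** The lowest order in which the bracket of two jets that vanish below orders k and s
    can be nonzero is k + s - 1, where it is that of their homogeneous parts. *)
Lemma bracket_taylor_eq0 k s a b : (0 < k)%N ->
  (forall i j, jet_sym (a i j)) -> (forall i j, jet_sym (b i j)) ->
  (forall i j t, (size t < k)%N -> a i j t = 0) ->
  (forall i j t, (size t < s)%N -> b i j t = 0) ->
  (forall i j l t, size t = (k + s).-1 -> jet_bracket a b i j l t = 0) ->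
  forall i j l v, schouten22 (taylor_bivector k a) (taylor_bivector s b) i j l v = 0.
Proof.
move=> k0 sa sb a0 b0 ab0 i j l v; apply: (@euler_eq0 _ _ (k + s).-1).
  have -> : (k + s).-1%:R = k%:R + (s%:R - 1) :> R.
    by rewrite addrA -natrD -[in RHS](prednK (_ : 0 < k + s)%N) ?addn_gt0 ?k0// -natr1 addrK.
  exact: euler_bracket.
move=> t st.
rewrite (iter_partial_schouten22 openT)//; try exact: smooth_on_taylor_bivector.
rewrite -[RHS](ab0 i j l t st).
have half (c d : jets) p q i' j' l' : (p + q = k + s)%N ->
    (forall i j, jet_sym (c i j)) -> (forall i j, jet_sym (d i j)) ->
    (forall i j t, (size t < p)%N -> c i j t = 0) ->
    (forall i j t, (size t < q)%N -> d i j t = 0) ->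
    jet_half (jet (taylor_bivector p c) 0) (jet (taylor_bivector q d) 0) i' j' l' t
    = jet_half c d i' j' l' t.
  move=> pq sc sd c0 d0; rewrite /jet_half big_seq [RHS]big_seq.
  apply: eq_bigr => u ut; apply: eq_bigr => h _.
  have su := splits_size ut.
  have {}su : (size u.1 + (size u.2).+1 = p + q)%N.
    by rewrite addnS su st prednK ?addn_gt0 ?k0.
  rewrite !jet_taylor_bivector// size_cat /= addn1.
  have [lt|gt|eq] := ltngtP (size u.1) p.
  - by rewrite c0// !mul0r.
  - by rewrite mul0r d0 ?mulr0// size_cat addn1 -(ltn_add2l (size u.1)) su ltn_add2r.
  - by rewrite -(eqn_add2l p) -{1}eq su eqxx.
by rewrite /jet_bracket !half//; rewrite addnC.
Qed.

End Bracket.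

(** * Exactness of the linearised Jacobi identity *)

Section Cohomology.
Variables (R : realType) (n k : nat).
Variable a : 'I_n -> 'I_n -> seq 'I_n -> R.
Hypotheses (k0 : (0 < k)%N) (sa : forall i j, jet_sym (a i j))
  (a0 : forall i j t, (size t < k)%N -> a i j t = 0).
Let P := taylor_bivector k a.

Lemma LP_im0 (s : int) : LP_im P k s 0.
Proof.
exists (fun=> 0).
  move=> i; rewrite /homogeneous_poly; case: (s - k%:Z + 1) => [d|d] /=.
    by exists (fun=> 0) => v; rewrite mxE big1// => t _; rewrite mul0r.
  by move=> v; rewrite mxE.
apply/funext => v; apply/matrixP => i j; rewrite !mxE big1// => h _ /=.
by rewrite !partial_cst !mulr0 [(0 : 'rV[R]_n) 0 h]mxE mul0r subr0 addr0.
Qed.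

(** A set of cosets reduced to the trivial one means that every cocycle is
    a coboundary. *)
Lemma LP_exact (s : nat) (B : 'rV[R]_n -> 'M[R]_n) :
  H2LP P k s%:Z = [set LP_class P k s%:Z 0] -> LP_ker P s%:Z B -> LP_im P k s%:Z B.
Proof.
move=> H2 kerB.
have : [set LP_class P k s%:Z 0] (LP_class P k s%:Z B) by rewrite -H2; exists B.
move=> /= E.
have : LP_class P k s%:Z B B by rewrite /LP_class /= subrr; exact: LP_im0.
by rewrite E /LP_class /= subr0.
Qed.

(** In degree below k-1 the image is zero, there being no vector field of negative
    degree, and so is the right-hand side; in degree k-1 it consists of the derivatives
    of the homogeneous part along constant vectors. *)
Lemma LP_im_jet s (B : 'rV[R]_n -> 'M[R]_n) : (s < k)%N -> LP_im P k s%:Z B ->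
  exists x : 'rV[R]_n, forall i j t, size t = s ->
    jet B 0 i j t = \sum_h x 0 h * a i j (h :: t).
Proof.
move=> sk [X hX <-].
have [sk1|sk1] := ltnP s k.-1.
  exists 0 => i j t st.
  have hd : s%:Z - k%:Z + 1 = Negz (k - s).-2 by lia.
  have X0 v : X v = 0.
    by apply/rowP => h; have := hX h; rewrite /homogeneous_poly hd mxE => ->.
  rewrite [RHS]big1 => [|h _]; last by rewrite mxE mul0r.
  rewrite /jet.
  have -> : (fun y => schouten21 P X y i j) = (fun=> 0).
    apply/funext => y; rewrite mxE big1// => h _.
    have E j' : (fun w : 'rV[R]_n => X w 0 j') = (fun=> 0).
      by apply/funext => w; rewrite X0 mxE.
    by rewrite !E !partial_cst !mulr0 X0 [(0 : 'rV[R]_n) 0 h]mxE mul0r subr0 addr0.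
  have /= := @smooth_on_cst R n setT 0.
  suff -> : iter_partial t (fun=> 0) = (fun=> 0) :> ('rV[R]_n -> R) by [].
  by elim: t {st} => [//|h t /= ->]; apply/funext => y; exact: partial_cst.
have hd : s%:Z - k%:Z + 1 = Posz 0 by lia.
have [c Xc] : exists c : 'I_n -> R, forall v h, X v 0 h = c h.
  have /choice[c cX] : forall h, exists c : R, forall v, X v 0 h = c.
    move=> h; have := hX h; rewrite /homogeneous_poly hd => -[b bE].
    exists (b [tuple]) => v; rewrite bE (big_pred1 [tuple]) ?big_nil ?mulr1//.
    by move=> t; apply/esym/eqP; exact: tuple0.
  by exists c.
(* The bracket with a constant vector field is minus the derivative along it. *)
exists (\row_h - c h) => i j t st.
pose e := fun u => \sum_h (- c h) * a i j (h :: u).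
have se : jet_sym e.
  by move=> u w uw; apply: eq_bigr => h _; congr (_ * _); apply: sa; rewrite perm_cons.
have -> : jet (schouten21 P X) 0 i j t = iter_partial t (taylor_term k.-1 e) 0.
  congr (iter_partial t _ _); apply/funext => v; rewrite mxE.
  have dP h : partial h (fun y => P y i j) v
      = taylor_term k.-1 (fun u => a i j (h :: u)) v.
    rewrite -partial_taylor// prednK//; congr partial.
    by apply/funext => y; rewrite mxE.
  have dX h j' : partial h (fun y => X y 0 j') v = 0.
    by under eq_fun do rewrite Xc; rewrite partial_cst.
  rewrite taylor_termE mulr_sumr.
  under [RHS]eq_bigr do rewrite mulr_suml mulr_sumr.
  rewrite exchange_big; apply: eq_bigr => h _ /=.
  rewrite !dX !mulr0 !add0r dP Xc taylor_termE mulr_sumr mulr_sumr -sumrN.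
  by apply: eq_bigr => u _; ring.
rewrite iter_partial_taylor// st ifT; last by lia.
by apply: eq_bigr => h _; rewrite mxE.
Qed.

(** The cohomological hypothesis makes the linearised Jacobi identity exact on
    jets of order below k, up to translations of the base point. *)
Lemma jet_bracket_exact (b : 'I_n -> 'I_n -> seq 'I_n -> R) :
  (forall s, (s <= k.-1)%N -> H2LP P k s%:Z = [set LP_class P k s%:Z 0]) ->
  (forall i j, jet_sym (b i j)) -> (forall i j t, b i j t = - b j i t) ->
  (forall i j l t, (size t < (2 * k).-1)%N -> jet_bracket a b i j l t = 0) ->
  exists x : 'rV[R]_n, forall i j t, (size t < k)%N ->
    b i j t = \sum_h x 0 h * a i j (h :: t).
Proof.
move=> hH sb skb ab0.
have step s : (s < k)%N -> (forall i j t, (size t < s)%N -> b i j t = 0) ->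
    exists x : 'rV[R]_n, forall i j t, size t = s ->
      b i j t = \sum_h x 0 h * a i j (h :: t).
  move=> sk b0.
  have [|x xE] := @LP_im_jet s (taylor_bivector s b) sk.
    apply: LP_exact; first by apply: hH; lia.
    split; first exact: hom_bivectors_taylor.
    apply: bracket_taylor_eq0 => // i j l t st; apply: ab0; lia.
  exists x => i j t st; rewrite -xE//.
  by rewrite jet_taylor_bivector// st eqxx.
have low s : (s < k)%N -> forall i j t, (size t < s)%N -> b i j t = 0.
  elim: s => [//|s IHs] sk i j t ts.
  have {}IHs := IHs (ltnW sk).
  have [|st] := ltnP (size t) s; first exact: IHs.
  have [x xE] := step s (ltnW sk) IHs.
  rewrite xE; last by lia.
  by rewrite big1// => h _; rewrite a0 ?mulr0//=; lia.
have [x xE] := step k.-1 ltac:(lia) (low k.-1 ltac:(lia)).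
exists x => i j t tk; have [tk1|tk1] := ltnP (size t) k.-1.
  rewrite (low k.-1)//; last by lia.
  by rewrite big1// => h _; rewrite a0 ?mulr0//=; lia.
by apply: xE; lia.
Qed.

End Cohomology.

Section Remainder.
Variables (R : realType) (n k : nat).
Variables (a q : 'I_n -> 'I_n -> seq 'I_n -> R).

(** The part of order below k of a jet. *)
Definition jet_trunc (i j : 'I_n) (t : seq 'I_n) : R :=
  if (size t < k)%N then q i j t else 0.

(** If q is a zero of the full bracket, close to a, then its truncation is almost
    a zero of the bracket with a: the defect is quadratic. *)
Lemma jet_bracket_trunc (e tau : R) i j l t : 0 <= e -> 0 <= tau ->
  (forall i j t, (size t < k)%N -> a i j t = 0) ->
  (forall i j t, (size t <= 2 * k)%N -> `|q i j t - a i j t| <= e) ->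
  (forall i j t, (size t < k)%N -> `|q i j t| <= tau) ->
  (size t < (2 * k).-1)%N -> jet_bracket q q i j l t = 0 ->
  `|jet_bracket a jet_trunc i j l t| <= 3 * ((2 ^ (2 * k))%:R * n%:R * (e * tau)).
Proof.
move=> e0 tau0 a0 qa qtau tk q0.
set K := _ * (e * tau).
have term i' h j' l' (u : seq 'I_n * seq 'I_n) : u \in splits t ->
   `|q i' h u.1 * q j' l' (u.2 ++ [:: h])
    - (a i' h u.1 * jet_trunc j' l' (u.2 ++ [:: h])
       + jet_trunc i' h u.1 * a j' l' (u.2 ++ [:: h]))| <= e * tau.
  move=> /splits_size us; rewrite /jet_trunc.
  have us' : (size u.1 + size (u.2 ++ [:: h]) < 2 * k)%N.
    by rewrite size_cat/= addn1 addnS us -ltn_predRL.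
  set w := u.2 ++ [:: h] in us' *.
  have qe i1 j1 t1 : (size t1 < k)%N -> `|q i1 j1 t1| <= e.
    by move=> tk1; rewrite -[q _ _ _]subr0 -(a0 i1 j1 t1 tk1) qa//; lia.
  have [uk|uk] := ltnP (size u.1) k; have [wk|wk] := ltnP (size w) k.
  - rewrite !a0// mul0r mulr0 addr0 subr0 normrM.
    by apply: ler_pM => //; [exact: qe|exact: qtau].
  - rewrite mulr0 add0r -mulrBr normrM mulrC.
    by apply: ler_pM => //; [apply: qa; lia|exact: qtau].
  - rewrite mul0r addr0 -mulrBl normrM.
    by apply: ler_pM => //; [apply: qa; lia|exact: qtau].
  - by lia.
have half i' j' l' : `|jet_half q q i' j' l' t
    - (jet_half a jet_trunc i' j' l' t + jet_half jet_trunc a i' j' l' t)| <= K.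
  rewrite /jet_half -big_split -sumrB big_seq.
  rewrite (le_trans (ler_norm_sum _ _ _))//.
  apply: (@le_trans _ _ (\sum_(u <- splits t | u \in splits t) n%:R * (e * tau))).
    apply: ler_sum => u ut; rewrite -big_split -sumrB.
    rewrite (le_trans (ler_norm_sum _ _ _))//.
    apply: (@le_trans _ _ (\sum_(h < n) e * tau)).
      by apply: ler_sum => h _; exact: term.
    by rewrite sumr_const card_ord mulr_natl.
  rewrite -big_seq big_const_seq count_predT iter_addr_0 size_splits.
  rewrite -[leLHS]mulr_natl mulrA /K ler_wpM2r ?mulr_ge0// ler_wpM2r//.
  by rewrite ler_nat leq_pexp2l// (leq_trans (ltnW tk) (leq_pred _)).
have := half i j l; have := half j l i; have := half l i j.
have q2 : jet_half q q i j l t + jet_half q q j l i t + jet_half q q l i j t = 0.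
  by move: q0; rewrite /jet_bracket; lra.
rewrite !ler_norml /jet_bracket => /andP[? ?] /andP[? ?] /andP[? ?].
by apply/andP; split; lra.
Qed.

End Remainder.

(** * Spaces of jets *)

(** If the gradient of f stays close to d on a ball, then f is almost affine there. *)
Lemma mean_value_affine (R : realType) (n : nat) (f : 'rV[R]_n -> R) (x0 : 'rV[R]_n)
    (rho e : R) (d : 'I_n -> R) :
  (forall x, `|x - x0| <= rho -> differentiable f x) ->
  (forall h x, `|x - x0| <= rho -> `|partial h f x - d h| <= e) ->
  forall x y, `|x - x0| <= rho -> `|y - x0| <= rho ->
  `|f x - f y - \sum_h (x - y) 0 h * d h| <= n%:R * e * `|x - y|.
Proof.
move=> df de x y xr yr.
have inball (s : R) : 0 <= s -> s <= 1 -> `|y + s *: (x - y) - x0| <= rho.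
  move=> s0 s1.
  have -> : y + s *: (x - y) - x0 = (1 - s) *: (y - x0) + s *: (x - x0).
    by apply/rowP => i; rewrite !mxE; ring.
  have s1' : 0 <= 1 - s by rewrite subr_ge0.
  rewrite (le_trans (ler_normD _ _)) // !normrZ (ger0_norm s0) (ger0_norm s1').
  have -> : rho = (1 - s) * rho + s * rho by ring.
  by apply: lerD; exact: ler_wpM2l.
pose g (s : R) := f (y + s *: (x - y)).
have dg (s : R) : 0 <= s -> s <= 1 ->
    is_derive s 1 g ('D_(x - y) f (y + s *: (x - y))).
  by move=> s0 s1; apply: is_derive_line; exact/df/inball.
have [||s s01] := @MVT R g (fun s => 'D_(x - y) f (y + s *: (x - y))) 0 1 ltr01.
- by move=> s; rewrite in_itv/= => /andP[? ?]; apply: dg; exact: ltW.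
- apply: derivable_within_continuous => s; rewrite in_itv/= => /andP[s0 s1].
  by have [] := dg s s0 s1.
move: s01; rewrite in_itv/= => /andP[/ltW s0 /ltW s1].
rewrite /g scale1r scale0r addr0 subr0 mulr1 [y + _]addrC subrK => ->.
have sr := inball s s0 s1.
rewrite derive_partial; last exact: df.
rewrite -sumrB (le_trans (ler_norm_sum _ _ _)) //.
apply: (@le_trans _ _ (\sum_(h < n) e * `|x - y|)).
  apply: ler_sum => h _; rewrite -mulrBr normrM mulrC.
  by apply: ler_pM => //; [exact: de|exact: rV_norm_coord].
by rewrite sumr_const card_ord -[leLHS]mulr_natl mulrA.
Qed.

Section Encoding.
Variables (R : realType) (n k : nat).
Hypothesis k0 : (0 < k)%N.

(** Jets of order below k form a vector space of rows, indexed by the components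
    and the words of length at most k - 1. *)
Definition jet_index : finType := ({bseq k.-1 of 'I_n} * 'I_n * 'I_n)%type.

Definition jet_row (q : 'I_n -> 'I_n -> seq 'I_n -> R) : 'rV[R]_#|jet_index| :=
  \row_u (let w : jet_index := enum_val u in q w.1.2 w.2 w.1.1).

(** The jet coded by a row, extended by zero to the words of length k or more. *)
Definition row_jet (x : 'rV[R]_#|jet_index|) (i j : 'I_n) (t : seq 'I_n) : R :=
  if insub t is Some w then x 0 (enum_rank ((w, i, j) : jet_index)) else 0.

Lemma row_jetE x i j (w : {bseq k.-1 of 'I_n}) :
  row_jet x i j w = x 0 (enum_rank ((w, i, j) : jet_index)).
Proof. by rewrite /row_jet valK. Qed.

Lemma row_jet_big x i j t : (k <= size t)%N -> row_jet x i j t = 0.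
Proof. by move=> kt; rewrite /row_jet insubF//; apply/negbTE; rewrite -ltnNge prednK. Qed.

Lemma row_jetK q : row_jet (jet_row q) = jet_trunc k q.
Proof.
apply/funext => i; apply/funext => j; apply/funext => t; rewrite /jet_trunc.
case: ltnP => [tk|]; last exact: row_jet_big.
have tk' : (size t <= k.-1)%N by rewrite -ltnS prednK.
by rewrite -[t]/(val (Bseq tk')) row_jetE mxE enum_rankK.
Qed.

Lemma row_jet_linear (c : R) x y i j t :
  row_jet (c *: x + y) i j t = c * row_jet x i j t + row_jet y i j t.
Proof.
by rewrite /row_jet; case: insub => [w|]; rewrite ?mxE// mulr0 addr0.
Qed.

Lemma jet_row_norm q (c : R) : 0 <= c ->
  (forall i j t, (size t < k)%N -> `|q i j t| <= c) -> `|jet_row q| <= c.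
Proof.
move=> c0 qc; apply: rV_norm_le => // u; rewrite mxE; apply: qc.
by rewrite -[ltnRHS](prednK k0) ltnS size_bseq.
Qed.

Lemma jet_le_row_norm q i j t : (size t < k)%N -> `|q i j t| <= `|jet_row q|.
Proof.
move=> tk; have -> : q i j t = row_jet (jet_row q) i j t.
  by rewrite row_jetK /jet_trunc tk.
rewrite /row_jet; case: insub => [w|]; last by rewrite normr0.
exact: rV_norm_coord.
Qed.

End Encoding.

(** * Stability on an open subset of R^n *)

Section Local.
Variables (R : realType) (n k : nat) (a : 'I_n -> 'I_n -> seq 'I_n -> R).
Hypotheses (k0 : (0 < k)%N) (sa : forall i j, jet_sym (a i j))
  (a0 : forall i j t, (size t < k)%N -> a i j t = 0).
Hypothesis hH : forall s, (s <= k.-1)%N ->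
  H2LP (taylor_bivector k a) k s%:Z = [set LP_class (taylor_bivector k a) k s%:Z 0].

(** When a is the jet of a field at a point, the derivative there of the map that sends
    a point to the jet of order below k of the field.  The row h is the derivative in the
    direction h. *)
Let D : 'M[R]_(n, #|jet_index n k|) :=
  \matrix_(h, u) (let w : jet_index n k := enum_val u in a w.1.2 w.2 (h :: w.1.1)).

Lemma mulmx_jet_derivative (x : 'rV[R]_n) :
  x *m D = jet_row k (fun i j t => \sum_h x 0 h * a i j (h :: t)).
Proof. by apply/rowP => u; rewrite !mxE; apply: eq_bigr => h _; rewrite mxE. Qed.

Lemma jet_row_row_jet (x : 'rV[R]_#|jet_index n k|) : jet_row k (row_jet x) = x.
Proof.
apply/rowP => u; rewrite mxE /= row_jetE -[in RHS](enum_valK u).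
by case: (enum_val u) => [[w i] j].
Qed.

(** On symmetric skew jets of order below k that A kills, the bracket with a is
    bounded below. *)
Lemma jet_bracket_bounded_below (A : 'M[R]_(#|jet_index n k|, n)) :
  D *m A *m D = D ->
  exists2 C : R, 0 < C & forall (q : 'I_n -> 'I_n -> seq 'I_n -> R) (c : R), 0 <= c ->
    (forall i j, jet_sym (q i j)) -> (forall i j t, q i j t = - q j i t) ->
    jet_row k q *m A = 0 ->
    (forall i j l t, (size t < (2 * k).-1)%N ->
       `|jet_bracket a (jet_trunc k q) i j l t| <= c) ->
    `|jet_row k q| <= C * c.
Proof.
move=> DAD.
(* The equations: being killed by A; the bracket with a; symmetry; skewness. *)
pose W : finType := ('I_n + {bseq (2 * k).-2 of 'I_n} * 'I_n * 'I_n * 'I_n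
  + ({bseq k.-1 of 'I_n} * {bseq k.-1 of 'I_n} * 'I_n * 'I_n
     + {bseq k.-1 of 'I_n} * 'I_n * 'I_n))%type.
pose Z (w : W) (x : 'rV[R]_#|jet_index n k|) : R := match w with
  | inl (inl j) => (x *m A) 0 j
  | inl (inr w) => jet_bracket a (row_jet x) w.1.1.2 w.1.2 w.2 w.1.1.1
  | inr (inl w) => if perm_eq w.1.1.1 w.1.1.2
      then row_jet x w.1.2 w.2 w.1.1.1 - row_jet x w.1.2 w.2 w.1.1.2 else 0
  | inr (inr w) => row_jet x w.1.2 w.2 w.1.1 + row_jet x w.2 w.1.2 w.1.1
  end.
have [w c x y|x Zx|C C0 CZ] := @linear_system_bound R #|jet_index n k| W Z.
- case: w => [[j|w]|[w|w]] /=.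
  + by rewrite mulmxDl -scalemxAl !mxE.
  + rewrite -jet_bracket_linear; congr jet_bracket.
    apply/funext => i; apply/funext => j; apply/funext => t; exact: row_jet_linear.
  + case: ifP => _; last by rewrite mulr0 addr0.
    by rewrite !row_jet_linear; ring.
  + by rewrite !row_jet_linear; ring.
- have sx i j : jet_sym (row_jet x i j).
    move=> s t st; have [kt|tk] := leqP k (size t).
      by rewrite !row_jet_big// (perm_size st).
    have tk' : (size t <= k.-1)%N by rewrite -ltnS prednK.
    have sk' : (size s <= k.-1)%N by rewrite (perm_size st).
    have := Zx (inr (inl ((((Bseq sk' : {bseq _ of _}), (Bseq tk' : {bseq _ of _})), i), j))).
    by rewrite /Z /= st => /eqP; rewrite subr_eq0 => /eqP.
  have skx i j t : row_jet x i j t = - row_jet x j i t.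
    have [kt|tk] := leqP k (size t); first by rewrite !row_jet_big// oppr0.
    have tk' : (size t <= k.-1)%N by rewrite -ltnS prednK.
    have := Zx (inr (inr (((Bseq tk' : {bseq _ of _}), i), j))).
    by rewrite /Z /= => /eqP; rewrite addr_eq0 => /eqP.
  have [|y yE] := jet_bracket_exact k0 sa a0 hH sx skx.
    move=> i j l t tk; have tk' : (size t <= (2 * k).-2)%N.
      by rewrite -ltnS prednK//; lia.
    exact: (Zx (inl (inr ((((Bseq tk' : {bseq _ of _}), i), j), l)))).
  have xD : x = y *m D.
    rewrite mulmx_jet_derivative -[LHS]jet_row_row_jet; apply/rowP => u.
    by rewrite !mxE; apply: yE; rewrite -[ltnRHS](prednK k0) ltnS size_bseq.
  have xA : x *m A = 0.
    by apply/rowP => j; rewrite [RHS]mxE; exact: (Zx (inl (inl j))).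
  by rewrite xD -DAD !mulmxA -xD xA mul0mx.
- exists C => // q c c0 sq skq qA qc; apply: CZ => // -[[j|w]|[w|w]] /=.
  + by rewrite qA mxE normr0.
  + rewrite row_jetK//; apply: qc; rewrite -[ltnRHS]prednK ?ltnS ?size_bseq//; lia.
  + case: ifP => [st|]; last by rewrite normr0.
    by rewrite row_jetK// /jet_trunc (perm_size st) (sq _ _ _ _ st) subrr normr0.
  + rewrite row_jetK// /jet_trunc; case: ifP => _; last by rewrite addr0 normr0.
    by rewrite [q w.1.2 _ _]skq addNr normr0.
Qed.

(** The local form of the stability theorem, on an open subset of R^n. *)
Lemma local_stability : exists2 e : R, 0 < e &
  forall rho : R, 0 < rho -> exists2 delta : R, 0 < delta &
  forall (U : set 'rV[R]_n) (x0 : 'rV[R]_n) (sigma : 'rV[R]_n -> 'M[R]_n),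
    open U -> (forall x, `|x - x0| <= rho -> U x) ->
    (forall i j, smooth_on U (fun x => sigma x i j)) ->
    (forall x, (sigma x)^T = - sigma x) ->
    (forall x, U x -> forall i j l, schouten22 sigma sigma i j l x = 0) ->
    (forall x, `|x - x0| <= rho -> forall i j t, (size t <= 2 * k)%N ->
       `|jet sigma x i j t - a i j t| <= e) ->
    (forall i j t, (size t < k)%N -> `|jet sigma x0 i j t| <= delta) ->
  exists2 x, `|x - x0| <= rho &
    forall i j t, (size t < k)%N -> jet sigma x i j t = 0.
Proof.
have [A DAD [kappa kappa0 zero]] := almost_affine_zero D.
have [C C0 CP] := jet_bracket_bounded_below DAD.
have [K K0 KE] : exists2 K : R, 0 <= K &
    forall r, K * r = 3 * ((2 ^ (2 * k))%:R * n%:R * r).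
  exists (3 * ((2 ^ (2 * k))%:R * n%:R)); first by rewrite !mulr_ge0.
  by move=> r; rewrite !mulrA.
(* The first bound makes G almost affine up to kappa, the second makes the quadratic
   error in the Jacobi identity absorbable. *)
pose e : R := Num.min (kappa / n.+1%:R) ((2 * (1 + C * K))^-1).
have CK0 : 0 < 2 * (1 + C * K) by rewrite mulr_gt0// ltr_pwDl// mulr_ge0// ltW.
have e0 : 0 < e by rewrite lt_min divr_gt0// invr_gt0 CK0.
have ek : n%:R * e <= kappa.
  apply: (@le_trans _ _ (n.+1%:R * (kappa / n.+1%:R))).
    by apply: ler_pM => //; [exact: ltW|rewrite ler_nat|rewrite ge_min lexx].
  by rewrite mulrC divfK// pnatr_eq0.
have eC : C * K * e < 1.
  apply: (@le_lt_trans _ _ (C * K * (2 * (1 + C * K))^-1)).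
    by apply: ler_wpM2l; [rewrite mulr_ge0// ltW|rewrite ge_min lexx orbT].
  rewrite -[_^-1]mul1r mulrA mulr1 ltr_pdivrMr// mul1r.
  by have := mulr_ge0 (ltW C0) K0; lra.
exists e => // rho rho0; exists (kappa * rho); first exact: mulr_gt0.
move=> U x0 sigma oU rU ss skew Jac close small.
pose G x := jet_row k (jet sigma x).
have [x y xr yr||x xr GA] := zero rho x0 G rho0.
- have k00 : 0 <= kappa * `|x - y| by rewrite mulr_ge0// ltW.
  apply: rV_norm_le => // u; rewrite mulmx_jet_derivative !mxE.
  set w : jet_index n k := enum_val u.
  have wk : (size w.1.1 < k)%N by rewrite -[ltnRHS](prednK k0) ltnS size_bseq.
  apply: (@le_trans _ _ (n%:R * e * `|x - y|)); last exact: ler_wpM2r.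
  apply: (@mean_value_affine _ _ _ x0 rho e (fun h => a w.1.2 w.2 (h :: w.1.1))) => //.
    by move=> z zr; apply: (ss _ _ _ _ (rU _ zr)).
  by move=> h z zr; apply: (close z zr _ _ (h :: w.1.1)); exact: leq_trans wk (leq_pmull k _).
- by apply: jet_row_norm => //; rewrite mulr_ge0// ltW.
exists x => //.
have Ux := rU x xr.
have sq i j : jet_sym (jet sigma x i j).
  by move=> s t st; exact: (iter_partial_perm oU (ss i j) Ux st).
have skq i j t : jet sigma x i j t = - jet sigma x j i t.
  rewrite /jet -mulN1r -(iter_partialZ _ _ oU (ss j i) Ux).
  congr (iter_partial _ _ x); apply/funext => y.
  by rewrite mulN1r; have /matrixP/(_ j i) := skew y; rewrite !mxE.
have J0 i j l t : jet_bracket (jet sigma x) (jet sigma x) i j l t = 0.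
  rewrite -(iter_partial_schouten22 oU ss ss _ _ _ _ Ux).
  rewrite (iter_partial_eq (g := fun=> 0) t oU _ Ux); last by move=> y Uy; exact: Jac.
  by suff -> : iter_partial t (fun=> 0) = (fun=> 0) :> ('rV[R]_n -> R) by [];
    elim: t => [//|h t /= ->]; apply/funext => y; exact: partial_cst.
set q := jet sigma x in sq skq J0 *.
have e0' := ltW e0.
have tau : `|jet_row k q| <= C * (K * (e * `|jet_row k q|)).
  apply: CP => //; first by rewrite !mulr_ge0.
  move=> i j l t tk.
  rewrite KE.
  apply: (jet_bracket_trunc e0' _ a0) => //; first by move=> *; exact: close.
  by move=> *; exact: jet_le_row_norm.
have q0 : `|jet_row k q| = 0.
  apply/eqP; rewrite eq_le normr_ge0 andbT leNgt; apply/negP => q_gt0.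
  move: tau; rewrite !mulrA -[X in X <= _]mul1r ler_pM2r//.
  by rewrite leNgt eC.
move=> i j t tk; apply/eqP; rewrite -normr_eq0 eq_le normr_ge0 andbT -q0.
exact: jet_le_row_norm.
Qed.

End Local.

(** * Charts *)

Section Charts.
Variables (R : realType) (n : nat) (M : smooth_manifold R n).

Lemma chart_inv_cts (c : chart_idx M) x : chart_img (chart_at c) x ->
  {for x, continuous (chart_inv (chart_at c))}.
Proof.
move=> cx; have := @chart_inv_cont _ _ _ (chart_at c).
rewrite continuous_open_subspace; last exact: chart_img_open.
by apply; rewrite inE.
Qed.

(** The domain of the change of coordinates from the chart c to the chart d. *)
Definition overlap (c d : chart_idx M) : set 'rV[R]_n :=
  [set x | chart_img (chart_at c) x /\ chart_dom (chart_at d) (chart_inv (chart_at c) x)].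

Lemma open_overlap c d : open (overlap c d).
Proof.
rewrite openE => x [cx dx].
have Hc := open_nbhs_nbhs (conj (@chart_img_open _ _ _ (chart_at c)) cx).
have Hd := open_nbhs_nbhs (conj (@chart_dom_open _ _ _ (chart_at d)) dx).
exact: (@filterI _ _ (nbhs_filter x) _ _ Hc (chart_inv_cts cx Hd)).
Qed.

Lemma transition_overlap c d x : overlap c d x ->
  overlap d c (transition (chart_at c) (chart_at d) x).
Proof.
move=> [cx dx]; split; first exact: chart_map_in.
by rewrite /transition chart_mapK//; exact: chart_inv_in.
Qed.

Lemma smooth_on_transition c d j :
  smooth_on (overlap c d) (fun x => transition (chart_at c) (chart_at d) x 0 j).
Proof. exact: mf_smooth. Qed.

Lemma jacobianE (f : 'rV[R]_n -> 'rV[R]_n) x i j :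
  (forall j, differentiable (fun y => f y 0 j) x) ->
  jacobian f x i j = partial i (fun y => f y 0 j) x.
Proof.
move=> df; have dfx := differentiable_row df.
have := deriveEjacobian (delta_mx 0 i) dfx.
rewrite -rowE derive_mx; last exact: diff_derivable.
by move=> /rowP/(_ j); rewrite !mxE.
Qed.

(** The vanishing of a jet can be checked in any one chart: by the change of
    coordinates rule the components in another chart are combinations, with smooth
    coefficients and composed with the transition, of those in the given one. *)
Lemma jet_vanishes_in_chart (sigma : bivector_field M) c (p : M) r :
  chart_dom (chart_at c) p ->
  (forall i j t, (size t <= r)%N -> jet (sigma c) (chart_map (chart_at c) p) i j t = 0) ->
  jet_vanishes r sigma p.
Proof.
move=> cp s0 d dp t j l tr.
pose T := transition (chart_at c) (chart_at d).
pose phi := transition (chart_at d) (chart_at c).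
have oV : open (overlap d c) by exact: open_overlap.
have oV' : open (overlap c d) by exact: open_overlap.
have Vp : overlap d c (chart_map (chart_at d) p).
  by split; [exact: chart_map_in|rewrite chart_mapK].
have phip : phi (chart_map (chart_at d) p) = chart_map (chart_at c) p.
  by rewrite /phi /transition chart_mapK.
have V'p : overlap c d (chart_map (chart_at c) p).
  by split; [exact: chart_map_in|rewrite chart_mapK].
pose f u w x := partial u (fun y => T y 0 j) x * partial w (fun y => T y 0 l) x.
pose F x := \sum_w \sum_u f u w x * sigma c x u w.
have sT i : smooth_on (overlap c d) (fun y => T y 0 i) by exact: smooth_on_transition.
have sf u w : smooth_on (overlap c d) (f u w).
  by apply: smooth_onM => //; exact: smooth_on_partial.
have ss u w : smooth_on (overlap c d) (fun x => sigma c x u w).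
  by apply: (@smooth_on_sub _ _ (chart_img (chart_at c))) => [x []//|]; exact: bv_smooth.
have sfs u w : smooth_on (overlap c d) (fun x => f u w x * sigma c x u w).
  exact: smooth_onM.
have sF : smooth_on (overlap c d) F.
  by apply: smooth_on_sum => // w; exact: smooth_on_sum.
have F0 s : (size s <= r)%N -> iter_partial s F (phi (chart_map (chart_at d) p)) = 0.
  move=> sr; rewrite phip (iter_partial_sum _ _ oV')//; last first.
    by move=> w; exact: smooth_on_sum.
  rewrite big1// => w _; rewrite (iter_partial_sum _ _ oV')// big1// => u _.
  exact: (flatM oV' (sf u w) (ss u w) V'p (s0 u w)).
have E y : overlap d c y -> sigma d y j l = F (phi y).
  move=> [dy cy]; have := bv_change sigma cy (chart_inv_in dy).
  rewrite chart_invK// => -> /=.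
  have Jphi u i : jacobian T (phi y) u i = partial u (fun y => T y 0 i) (phi y).
    apply: jacobianE => i'; apply: smooth_on_diff (sT i') _.
    exact: transition_overlap.
  rewrite -/T -[chart_map _ _]/(phi y) mxE; apply: eq_bigr => w _.
  rewrite mxE Jphi mulr_suml; apply: eq_bigr => u _.
  by rewrite mxE Jphi mulrAC.
rewrite (iter_partial_eq t oV E Vp).
apply: (flat_comp oV sF _ _ Vp F0) => //.
  by move=> i; exact: smooth_on_transition.
by move=> x; exact: transition_overlap.
Qed.

Lemma homogeneous_partE (pi : bivector_field M) k c (m : M) :
  homogeneous_part k pi c m
  = taylor_bivector k (jet (pi c) (chart_map (chart_at c) m)).
Proof.
by apply/funext => v; apply/matrixP => i j; rewrite !mxE taylor_termE.
Qed.

End Charts.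

Lemma near_closed_ball (R : realType) (n : nat) (x0 : 'rV[R]_n) (P : 'rV[R]_n -> Prop) :
  (\forall x \near x0, P x) ->
  exists2 rho : R, 0 < rho & forall x, `|x - x0| <= rho -> P x.
Proof.
move=> /nbhs_ballP[r /= r0 rP]; exists (r / 2); first exact: divr_gt0.
move=> x xr; apply: rP; rewrite -ball_normE /ball_/= distrC (le_lt_trans xr)//.
by rewrite ltr_pdivrMr// ltr_pMr// ltr1n.
Qed.

Theorem theorem1p2 (R : realType) (n : nat) (M : smooth_manifold R n)
    (pi : bivector_field M) (k : nat) (m : M) (c : chart_idx M)
    (hpi : poisson pi) (hk : (1 <= k)%N) (hm : singularity k pi m)
    (hc : chart_dom (chart_at c) m)
    (hH : forall s : nat, (s <= k.-1)%N ->
       H2LP (homogeneous_part k pi c m) k s%:Z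
       = [set LP_class (homogeneous_part k pi c m) k s%:Z 0]) :
  stable_singularity k (2 * k) pi m.
Proof.
pose C := chart_at c; set x0 := chart_map C m.
have Cx0 : chart_img C x0 by exact: chart_map_in.
have oC : open (chart_img C) := @chart_img_open _ _ _ C.
pose a := jet (pi c) x0.
have sjet (sigma : bivector_field M) i j :
  smooth_on (chart_img C) (fun x => sigma c x i j) by exact: bv_smooth.
have sa i j : jet_sym (a i j).
  by move=> s t st; exact: (iter_partial_perm oC (sjet pi i j) Cx0 st).
have [_ hlow hhigh] := hm.
have a0 i j t : (size t < k)%N -> a i j t = 0.
  by move=> tk; apply: hlow => //; rewrite -ltnS prednK.
have {}hH s : (s <= k.-1)%N -> H2LP (taylor_bivector k a) k s%:Z
    = [set LP_class (taylor_bivector k a) k s%:Z 0].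
  by move=> /hH; rewrite homogeneous_partE.
have [i1 [j1 [t1 [t1k a1]]]] : exists i j t, (size t <= k)%N /\ a i j t != 0.
  apply: contrapT => na; apply: hhigh; apply: (jet_vanishes_in_chart hc) => i j t tk.
  apply/eqP/negPn/negP => at0; apply: na; exists i, j, t.
  by split.
have [e e0 local] := local_stability hk sa a0 hH.
pose e1 := Num.min e (`|a i1 j1 t1| / 2).
have e10 : 0 < e1 by rewrite lt_min e0 divr_gt0// normr_gt0.
move=> Omega Om.
have near1 : \forall x \near x0, chart_img C x.
  exact: open_nbhs_nbhs (conj oC Cx0).
have near2 : \forall x \near x0, Omega (chart_inv C x).
  by apply: (chart_inv_cts Cx0); rewrite chart_mapK.
have near3 : \forall x \near x0, forall w : {bseq (2 * k) of 'I_n} * 'I_n * 'I_n,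
    `|a w.1.2 w.2 w.1.1 - jet (pi c) x w.1.2 w.2 w.1.1| < e1 / 2.
  apply: (@filter_forall _ _ _ (nbhs x0) (nbhs_filter x0)) => w.
  have := differentiable_continuous (sjet pi w.1.2 w.2 w.1.1 x0 Cx0).
  by move=> /cvgrPdist_lt; apply; rewrite divr_gt0.
have [r1 r10 r1P] := near_closed_ball near1.
have [r2 r20 r2P] := near_closed_ball near2.
have [r3 r30 r3P] := near_closed_ball near3.
pose rho := Num.min r1 (Num.min r2 r3).
have rho0 : 0 < rho by rewrite !lt_min r10 r20 r30.
have rho1 x : `|x - x0| <= rho -> chart_img C x.
  by move=> xr; apply: r1P; rewrite (le_trans xr)// ge_min lexx.
have rho2 x : `|x - x0| <= rho -> Omega (chart_inv C x).
  by move=> xr; apply: r2P; rewrite (le_trans xr)// !ge_min lexx !orbT.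
have rho3 x : `|x - x0| <= rho -> forall i j t, (size t <= 2 * k)%N ->
    `|jet (pi c) x i j t - a i j t| < e1 / 2.
  move=> xr i j t tk; rewrite distrC.
  apply: (r3P x _ ((Bseq tk : {bseq _ of _}), i, j)).
  by rewrite (le_trans xr)// !ge_min lexx !orbT.
have [delta delta0 {}local] := local rho rho0.
pose e2 := Num.min (e1 / 2) delta.
have e20 : 0 < e2 by rewrite lt_min delta0 divr_gt0.
pose K : set M := chart_inv C @` [set x | `|x - x0| <= rho].
pose W : set (bivector_field M) := [set sigma | forall p, K p ->
  forall t (i j : 'I_n), (size t <= 2 * k)%N ->
  `|jet (sigma c) (chart_map C p) i j t - jet (pi c) (chart_map C p) i j t| < e2].
exists W.
  exists 1%N, (fun=> c), (fun=> K), e2; split=> //.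
    move=> _; split; last by move=> _ [x xr <-]; apply: chart_inv_in; exact: rho1.
    apply: continuous_compact; last exact: closed_ball_rV_compact.
    apply: continuous_subspaceW (@chart_inv_cont _ _ _ C) => x xr; exact: rho1.
  by move=> sigma sW p Kp t i j tk; exact: (sW ord0 p Kp t i j tk).
move=> sigma sP sW.
have close x : `|x - x0| <= rho -> forall i j t, (size t <= 2 * k)%N ->
    `|jet (sigma c) x i j t - jet (pi c) x i j t| < e2.
  move=> xr i j t tk; have Cx := rho1 x xr.
  have Kx : K (chart_inv C x) by exists x.
  by have := sW _ Kx t i j tk; rewrite chart_invK.
have close1 x : `|x - x0| <= rho -> forall i j t, (size t <= 2 * k)%N ->
    `|jet (sigma c) x i j t - a i j t| < e1.
  move=> xr i j t tk; rewrite -(subrKA (jet (pi c) x i j t)).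
  rewrite (le_lt_trans (ler_normD _ _)) // [ltRHS]splitr.
  apply: ltrD; last exact: rho3.
  by apply: lt_le_trans (close x xr i j t tk) _; rewrite ge_min lexx.
have xx0 : `|x0 - x0| <= rho by rewrite subrr normr0 ltW.
have [||||||x xr x0k] := local (chart_img C) x0 (sigma c) oC.
- exact: rho1.
- exact: sjet.
- exact: bv_skew.
- by move=> x Cx i j l; exact: sP.
- move=> x xr i j t tk; apply: le_trans (ltW (close1 x xr i j t tk)) _.
  by rewrite ge_min lexx.
- move=> i j t tk; rewrite -[jet _ _ _ _ _]subr0 -(a0 i j t tk).
  have tk2 : (size t <= 2 * k)%N by rewrite (leq_trans (ltnW tk))// leq_pmull.
  by apply: le_trans (ltW (close x0 xx0 i j t tk2)) _; rewrite ge_min lexx orbT.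
have Cx := rho1 x xr.
have domx : chart_dom C (chart_inv C x) by exact: chart_inv_in.
exists (chart_inv C x); first exact: rho2.
split=> //.
  apply: (jet_vanishes_in_chart domx) => i j t tk.
  by rewrite chart_invK//; apply: x0k; rewrite -ltnS prednK in tk.
move=> /(_ c domx t1 i1 j1 t1k); rewrite chart_invK// => s10.
have t1k2 : (size t1 <= 2 * k)%N by rewrite (leq_trans t1k)// leq_pmull.
have := close1 x xr i1 j1 t1 t1k2; rewrite {1}/jet s10 sub0r normrN lt_min => /andP[_].
by rewrite ltr_pdivlMr// ltNge ler_peMr// ler1n.
Qed.
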